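(* There exist complete two-dimensional expanding Ricci solitons with negative curvature that are topologically disks and are not hyperbolic space (i.e. are not isometric, even up to scaling, to the hyperbolic plane). Namely, the metrics $g_7(\nu)$, $\nu\in(2\pi,\infty)$, and the universal covers of the metrics $g_8(\nu)$, $\nu\in(0,\infty)$, described in the context, are such solitons.
   Context: A Ricci soliton with expansion constant $\lambda$ is a triple $(M,g,X)$, with $g$ a smooth Riemannian metric and $X$ a smooth vector field on $M$, satisfying $-2\mathrm{Ric}(g)=L_Xg-2\lambda g$; it is expanding if $\lambda<0$. For an interval $I\subset(0,\infty)$ and a smooth $a:I\to(0,\infty)$ let $G_a=\frac{a(t)^2}{t}dt^2+4t\,d\theta^2$ on $I\times(\mathbb{R}/2\pi\mathbb{Z})$. For $\lambda,\mu<0$ and $\gamma=\frac{2\mu}{\lambda}>0$ consider the equation $a'(t)=4\mu a(t)^2\left(\frac{a(t)}{\gamma}-1\right)$. - $g_7(\nu)$, $\nu\in(2\pi,\infty)$: $\lambda,\mu<0$ with $\gamma=2\pi/\nu<1$, and $a$ is the solution on $[0,\infty)$ with $a(0)=1$; $g_7(\nu)$ is the smooth extension of $G_a$ (from $I=(0,\infty)$) over a point added at $t=0$, giving a metric on $\mathbb{R}^2$. (The remaining freedom in $\mu$ amounts to scaling the metric.) - $g_8(\nu)$, $\nu\in(0,\infty)$: $\lambda=-1$, $\mu<0$ with $\gamma=2\pi/\nu$, and $a$ is the solution on $(0,\infty)$ with $a(t)\to+\infty$ as $t\to0^+$; $g_8(\nu)=G_a$ on $(0,\infty)\times(\mathbb{R}/2\pi\mathbb{Z})\cong\mathbb{R}^2\setminus\{0\}$.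 *)

(* Defs.v *)
(* Stdlib reals with Coquelicot. *)
From Stdlib Require Import Reals.
From Coquelicot Require Import Coquelicot.
Open Scope R_scope.

(** Riemannian geometry of open subsets of the plane, in the global chart.
    Every surface below (the plane, the punctured plane, a half-plane) is such
    a subset.  Objects are total functions on [R * R]; only their values near
    points of the (open) domain matter. *)

Definition pt : Type := (R * R)%type.

Inductive idx : Set := i1 | i2.

Definition sum2 (F : idx -> R) : R := F i1 + F i2.

Definition coord (i : idx) (p : pt) : R :=
  match i with i1 => fst p | i2 => snd p end.

Definition pd (i : idx) (f : pt -> R) (p : pt) : R :=
  match i with
  | i1 => Derive (fun x => f (x, snd p)) (fst p)
  | i2 => Derive (fun y => f (fst p, y)) (snd p)
  end.

(** [ex_diff_n f n x y]: all iterated partial derivatives of [f] of order at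
    most [n] exist and are continuous at [(x, y)]. *)
Definition smooth_on (U : pt -> Prop) (f : pt -> R) : Prop :=
  forall (n : nat) (p : pt), U p ->
    ex_diff_n (fun x y => f (x, y)) n (fst p) (snd p).

Definition smooth_map (U : pt -> Prop) (phi : pt -> pt) : Prop :=
  forall i, smooth_on U (fun p => coord i (phi p)).

Definition vfield : Type := idx -> pt -> R.
Definition metric : Type := idx -> idx -> pt -> R.

Definition riemannian (U : pt -> Prop) (g : metric) : Prop :=
  open U /\
  (forall i j, smooth_on U (g i j)) /\
  (forall p, U p -> g i1 i2 p = g i2 i1 p) /\
  (forall p, U p -> forall v : idx -> R, (exists i, v i <> 0) ->
     0 < sum2 (fun i => sum2 (fun j => g i j p * v i * v j))).

Definition detg (g : metric) (p : pt) : R :=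
  g i1 i1 p * g i2 i2 p - g i1 i2 p * g i2 i1 p.

Definition ginv (g : metric) (i j : idx) (p : pt) : R :=
  match i, j with
  | i1, i1 => g i2 i2 p / detg g p
  | i2, i2 => g i1 i1 p / detg g p
  | i1, i2 => - g i1 i2 p / detg g p
  | i2, i1 => - g i2 i1 p / detg g p
  end.

(** [christoffel g k i j] is Gamma^k_{ij}. *)
Definition christoffel (g : metric) (k i j : idx) (p : pt) : R :=
  / 2 * sum2 (fun l =>
    ginv g k l p * (pd i (g j l) p + pd j (g i l) p - pd l (g i j) p)).

(** [riem g l k i j] is the coefficient of d_l in R(d_i, d_j) d_k. *)
Definition riem (g : metric) (l k i j : idx) (p : pt) : R :=
  pd i (christoffel g l j k) p - pd j (christoffel g l i k) p
  + sum2 (fun m => christoffel g l i m p * christoffel g m j k p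
                   - christoffel g l j m p * christoffel g m i k p).

Definition ricci (g : metric) (j k : idx) (p : pt) : R :=
  sum2 (fun i => riem g i k i j p).

(** Sectional curvature <R(d_1,d_2)d_2, d_1> / det g of the tangent plane. *)
Definition curvature (g : metric) (p : pt) : R :=
  sum2 (fun l => g i1 l p * riem g l i2 i1 i2 p) / detg g p.

Definition lie_metric (X : vfield) (g : metric) (i j : idx) (p : pt) : R :=
  sum2 (fun k => X k p * pd k (g i j) p
                 + g k j p * pd i (X k) p + g i k p * pd j (X k) p).

Definition ricci_soliton (U : pt -> Prop) (g : metric) (X : vfield)
    (lam : R) : Prop :=
  riemannian U g /\ (forall i, smooth_on U (X i)) /\
  forall p, U p -> forall i j,
    -2 * ricci g i j p = lie_metric X g i j p - 2 * lam * g i j p.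

(** Curves are C^1 on all of [R]; this loses nothing, since a C^1 curve on
    [[a, b]] extends. *)
Definition C1_curve (c : R -> pt) : Prop :=
  forall i t, ex_derive (fun s => coord i (c s)) t /\
              continuous (Derive (fun s => coord i (c s))) t.

Definition speed (g : metric) (c : R -> pt) (t : R) : R :=
  sqrt (sum2 (fun i => sum2 (fun j =>
    g i j (c t) * Derive (fun s => coord i (c s)) t
                * Derive (fun s => coord j (c s)) t))).

(** There is a piecewise C^1 curve in [U] from [p] to [q] of [g]-length [L]. *)
Inductive curve_length (U : pt -> Prop) (g : metric) : pt -> pt -> R -> Prop :=
| length_piece (c : R -> pt) (a b : R) :
    a <= b -> C1_curve c -> (forall t, a <= t <= b -> U (c t)) ->
    curve_length U g (c a) (c b) (RInt (speed g c) a b)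
| length_concat (p q r : pt) (L1 L2 : R) :
    curve_length U g p q L1 -> curve_length U g q r L2 ->
    curve_length U g p r (L1 + L2).

Definition riem_dist (U : pt -> Prop) (g : metric) (p q : pt) : Rbar :=
  Glb_Rbar (curve_length U g p q).

Definition complete_metric (U : pt -> Prop) (g : metric) : Prop :=
  forall u : nat -> pt, (forall n, U (u n)) ->
    (forall eps, 0 < eps -> exists N : nat, forall m n : nat,
       (N <= m)%nat -> (N <= n)%nat ->
       Rbar_lt (riem_dist U g (u m) (u n)) eps) ->
    exists p, U p /\
      forall eps, 0 < eps -> exists N : nat, forall n : nat, (N <= n)%nat ->
        Rbar_lt (riem_dist U g (u n) p) eps.

Definition pullback (phi : pt -> pt) (h : metric) : metric := fun i j p =>
  sum2 (fun k => sum2 (fun l =>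
    h k l (phi p) * pd i (fun q => coord k (phi q)) p
                  * pd j (fun q => coord l (phi q)) p)).

Definition inverse_on (U V : pt -> Prop) (phi psi : pt -> pt) : Prop :=
  (forall p, U p -> V (phi p) /\ psi (phi p) = p) /\
  (forall q, V q -> U (psi q) /\ phi (psi q) = q).

Definition isometric (U : pt -> Prop) (g : metric)
    (V : pt -> Prop) (h : metric) : Prop :=
  exists phi psi, inverse_on U V phi psi /\
    smooth_map U phi /\ smooth_map V psi /\
    forall p, U p -> forall i j, pullback phi h i j p = g i j p.

Definition isometric_up_to_scaling (U : pt -> Prop) (g : metric)
    (V : pt -> Prop) (h : metric) : Prop :=
  exists c, 0 < c /\ isometric U (fun i j p => c * g i j p) V h.

Definition diag_metric (e f : pt -> R) : metric := fun i j p =>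
  match i, j with
  | i1, i1 => e p
  | i2, i2 => f p
  | _, _ => 0
  end.

Definition upper_half_plane (p : pt) : Prop := 0 < snd p.
Definition hyperbolic_metric : metric :=
  diag_metric (fun p => / (snd p) ^ 2) (fun p => / (snd p) ^ 2).

Definition homeomorphic (U V : pt -> Prop) : Prop :=
  exists phi psi, inverse_on U V phi psi /\
    continuous_on U phi /\ continuous_on V psi.

Definition unit_disc (p : pt) : Prop := (fst p) ^ 2 + (snd p) ^ 2 < 1.

Definition unit_interval (t : R) : Prop := 0 <= t <= 1.
Definition unit_square (s : pt) : Prop :=
  unit_interval (fst s) /\ unit_interval (snd s).

Definition path_in (U : pt -> Prop) (c : R -> pt) : Prop :=
  continuous_on unit_interval c /\ forall t, unit_interval t -> U (c t).

Definition simply_connected (U : pt -> Prop) : Prop :=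
  (exists p, U p) /\
  (forall p q, U p -> U q -> exists c, path_in U c /\ c 0 = p /\ c 1 = q) /\
  (forall c, path_in U c -> c 0 = c 1 ->
     exists H : pt -> pt, continuous_on unit_square H /\
       (forall s, unit_square s -> U (H s)) /\
       (forall t, unit_interval t -> H (0, t) = c t /\ H (1, t) = c 0) /\
       (forall s, unit_interval s -> H (s, 0) = c 0 /\ H (s, 1) = c 0)).

Definition covering_map (E : pt -> Prop) (pi : pt -> pt)
    (B : pt -> Prop) : Prop :=
  continuous_on E pi /\ (forall e, E e -> B (pi e)) /\
  (forall b, B b -> exists e, E e /\ pi e = b) /\
  forall b, B b -> exists V : pt -> Prop,
    open V /\ V b /\ (forall q, V q -> B q) /\
    exists (I : Type) (sheet : I -> pt -> Prop),
      (forall k, open (sheet k)) /\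
      (forall k l e, sheet k e -> sheet l e -> k = l) /\
      (forall e, (E e /\ V (pi e)) <-> exists k, sheet k e) /\
      (forall k, exists sigma, inverse_on (sheet k) V pi sigma /\
                               continuous_on V sigma).

(** [(E, gE)] is the Riemannian universal cover of [(B, gB)] via [pi]. *)
Definition riemannian_universal_cover (E : pt -> Prop) (gE : metric)
    (pi : pt -> pt) (B : pt -> Prop) (gB : metric) : Prop :=
  riemannian E gE /\ simply_connected E /\ covering_map E pi B /\
  smooth_map E pi /\
  forall p, E p -> forall i j, pullback pi gB i j p = gE i j p.

(** The class of solitons in question; [lam] is the expansion constant. *)
Definition nonhyperbolic_expanding_disc (U : pt -> Prop) (g : metric)
    (lam : R) : Prop :=
  lam < 0 /\ (exists X, ricci_soliton U g X lam) /\
  complete_metric U g /\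
  (forall p, U p -> curvature g p < 0) /\
  homeomorphic U unit_disc /\
  ~ isometric_up_to_scaling U g upper_half_plane hyperbolic_metric.

(** [a] is a positive solution on the interval [I] of
    a' = 4 mu a^2 (a / gamma - 1), gamma = 2 mu / lam, the derivative being
    taken within [I] (one-sided at an end point).  Smoothness of [a] is
    automatic. *)
Definition solution_on (lam mu : R) (I : R -> Prop) (a : R -> R) : Prop :=
  forall t, I t -> 0 < a t /\
    filterdiff a (within I (locally t))
      (fun h => scal h (4 * mu * a t ^ 2 * (a t / (2 * mu / lam) - 1))).

Definition half_plane (p : pt) : Prop := 0 < fst p.
Definition plane (p : pt) : Prop := True.
Definition punctured_plane (p : pt) : Prop := p <> (0, 0).

(** G_a in the coordinates (t, theta) on (0, oo) x R. *)
Definition G (a : R -> R) : metric :=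
  diag_metric (fun p => a (fst p) ^ 2 / fst p) (fun p => 4 * fst p).

(** Induces the identification of (0, oo) x (R / 2 pi Z) with the punctured
    plane.  The radius has to be sqrt t, up to a factor, for the metric of [g7]
    to be smooth at the origin: with t = r^2,
    G_a = 4 (a(r^2)^2 dr^2 + r^2 dtheta^2). *)
Definition polar (p : pt) : pt :=
  (sqrt (fst p) * cos (snd p), sqrt (fst p) * sin (snd p)).

(** [g], read in the coordinates (t, theta), is G_a. *)
Definition is_G_in_polar (a : R -> R) (g : metric) : Prop :=
  forall p, half_plane p -> forall i j, pullback polar g i j p = G a i j p.

(** [g] is a metric g_7(nu) on the plane, for the parameters [lam], [mu]. *)
Definition is_g7 (nu lam mu : R) (g : metric) : Prop :=
  lam < 0 /\ mu < 0 /\ 2 * mu / lam = 2 * PI / nu /\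
  exists a, solution_on lam mu (fun t => 0 <= t) a /\ a 0 = 1 /\
    riemannian plane g /\ is_G_in_polar a g.

(** [g] is the metric g_8(nu) on the punctured plane. *)
Definition is_g8 (nu : R) (g : metric) : Prop :=
  exists mu a, mu < 0 /\ 2 * mu / (-1) = 2 * PI / nu /\
    solution_on (-1) mu (fun t => 0 < t) a /\
    filterlim a (at_right 0) (Rbar_locally p_infty) /\
    riemannian punctured_plane g /\ is_G_in_polar a g.

(* Main.v *)
Require Import Defs.
From Stdlib Require Import Reals.
From Coquelicot Require Import Coquelicot.
From Stdlib Require Import Lra Lia ZArith Ranalysis5.
Open Scope R_scope.

(** [G_a] has curvature [K = a' / (2 a^3) = lam - 2 mu / a], and
    [X = (4 mu t / a) d/dt] solves the soliton equation exactly because [a]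
    solves its ODE.  On the plane, [X = (2 mu / a(r^2)) (x, y)] with
    [a(r^2) = sqrt (det g) / 4], which is smooth, so the identities computed in
    Cartesian coordinates away from the origin extend to it by continuity.  Since
    [a > gamma], the curvature is negative and [a] is strictly decreasing; a
    metric isometric to a multiple of the hyperbolic one would have constant
    curvature.  Completeness follows from globally Lipschitz coordinates: [x, y]
    for [g7], and [ln t, arcsinh (theta sqrt t)] for the cover of [g8], where
    [a^2 t >= 1/4].  Solutions are obtained by inverting [z - 1 + exp (- z)]. *)

(** * Smooth functions *)

(** The claims concern every solution [a], so bounds, monotonicity and blow-up rate are derived from
    the equation itself, with no appeal to uniqueness of solutions; the explicit solution serves
    existence only. The bound on a^2 t comes from (1 / a^2)' = 4 + 8 mu / a <= 4, and a > gamma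
    holds because a - gamma satisfies a linear homogeneous equation. The obstacle for [g7] is the
    origin. The metric exists there only if (a^2 - 1) / t is smooth at t = 0: the solution is
    continued to slightly negative t and divided by Hadamard's lemma. Strict negativity of the
    curvature at the origin does not follow by continuity and uses a(0) = 1 > gamma. Invariance of
    curvature is needed for one target only, the hyperbolic half plane. There the two components of
    an isometry satisfy explicit Hessian equations, and equality of mixed third derivatives yields
    the curvature, without general transformation laws for Christoffel symbols. *)

(** The greatest class of functions closed under differentiation on [D],
    defined impredicatively to reason by coinduction. *)
Definition smooth1 (D : R -> Prop) (f : R -> R) : Prop :=
  exists P : (R -> R) -> Prop, P f /\
    forall h, P h -> exists h', P h' /\ forall x, D x -> is_derive h x (h' x).

Lemma smooth1_derive D f : smooth1 D f ->
  exists f', smooth1 D f' /\ forall x, D x -> is_derive f x (f' x).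
Proof.
intros [P [Pf HP]]; destruct (HP f Pf) as [f' [Pf' Hf']].
exists f'; split; [exists P|]; auto.
Qed.

Lemma smooth1_inv : smooth1 (fun x => x <> 0) (fun x => / x).
Proof.
exists (fun h => exists c n, h = fun x => c * (/ x) ^ S n); split.
  exists 1, 0%nat.
  apply FunctionalExtensionality.functional_extensionality; intros x; simpl; ring.
intros h [c [n ->]].
exists (fun x => (- c * INR (S n)) * (/ x) ^ S (S n)); split.
  now exists (- c * INR (S n)), (S n).
intros x Hx; auto_derive; [assumption|].
change (match n with 0%nat => 1 | S _ => INR n + 1 end) with (INR (S n)).
rewrite S_INR; simpl; field; assumption.
Qed.

(** The multiples of sqrt x / x^n form a class closed under differentiation, because 1 / (2 sqrt x)
    = sqrt x / (2 x). *)
Lemma smooth1_sqrt : smooth1 (fun x => 0 < x) sqrt.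
Proof.
exists (fun h => exists c n, h = fun x => c * sqrt x * (/ x) ^ n); split.
  exists 1, 0%nat.
  apply FunctionalExtensionality.functional_extensionality; intros x; simpl; ring.
intros h [c [n ->]].
exists (fun x => (c * (/ 2 - INR n)) * sqrt x * (/ x) ^ S n); split.
  now exists (c * (/ 2 - INR n)), (S n).
intros x Hx.
assert (Hs : sqrt x <> 0) by (apply Rgt_not_eq, sqrt_lt_R0, Hx).
assert (E : / (2 * sqrt x) = sqrt x * / x * / 2).
  rewrite <- (sqrt_sqrt x) at 3 by lra; field; assumption.
auto_derive; [repeat split; lra|].
rewrite E; destruct n as [|n]; [simpl; field; lra|].
change (match n with 0%nat => 1 | S _ => INR n + 1 end) with (INR (S n)).
rewrite S_INR; simpl; field; lra.
Qed.

Lemma smooth1_trig D u v : smooth1 D (fun x => u * cos x + v * sin x).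
Proof.
exists (fun h => exists c d, h = fun x => c * cos x + d * sin x); split.
  now exists u, v.
intros h [c [d ->]]; exists (fun x => d * cos x + - c * sin x); split.
  now exists d, (- c).
intros x _; auto_derive; [exact I|ring].
Qed.

Inductive polynomial_in (a : R -> R) : (R -> R) -> Prop :=
| polynomial_const c : polynomial_in a (fun _ => c)
| polynomial_self : polynomial_in a a
| polynomial_plus f g : polynomial_in a f -> polynomial_in a g ->
    polynomial_in a (fun x => f x + g x)
| polynomial_mult f g : polynomial_in a f -> polynomial_in a g ->
    polynomial_in a (fun x => f x * g x).

(** When a' is a polynomial in [a], the derivative of any polynomial in [a] is again one. The
    polynomials in [a] are therefore a witness class, and a merely differentiable solution is
    smooth. *)
Lemma smooth1_ode D a q h : polynomial_in a q ->
  (forall x, D x -> is_derive a x (q x)) -> polynomial_in a h -> smooth1 D h.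
Proof.
intros Hq Ha Hh; exists (polynomial_in a); split; [assumption|].
clear h Hh; intros h Hh; induction Hh as [c| |f g Hf [f' [Pf' Df]] Hg [g' [Pg' Dg]]
  |f g Hf [f' [Pf' Df]] Hg [g' [Pg' Dg]]].
- exists (fun _ => 0); split; [constructor|].
  intros x _; auto_derive; auto.
- now exists q.
- exists (fun x => f' x + g' x); split; [now constructor|].
  intros x Hx; apply (is_derive_plus f g); auto.
- exists (fun x => f' x * g x + f x * g' x); split; [now repeat constructor|].
  intros x Hx; apply (is_derive_mult f g); auto.
  intros; apply Rmult_comm.
Qed.

(** * Partial derivatives and smooth functions in the plane *)

Definition is_pd (i : idx) (f : pt -> R) (p : pt) (l : R) : Prop :=
  match i with
  | i1 => is_derive (fun x => f (x, snd p)) (fst p) l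
  | i2 => is_derive (fun y => f (fst p, y)) (snd p) l
  end.

Lemma is_pd_unique i f p l : is_pd i f p l -> pd i f p = l.
Proof. destruct i; apply is_derive_unique. Qed.

Lemma is_pd_const i c p : is_pd i (fun _ => c) p 0.
Proof. destruct i; simpl; auto_derive; auto. Qed.

Definition kronecker (i j : idx) : R :=
  match i, j with i1, i1 => 1 | i2, i2 => 1 | _, _ => 0 end.

Lemma is_pd_coord i j p : is_pd i (coord j) p (kronecker i j).
Proof. destruct i, j; simpl; auto_derive; auto. Qed.

Lemma is_pd_plus i f g p l m : is_pd i f p l -> is_pd i g p m ->
  is_pd i (fun q => f q + g q) p (l + m).
Proof. destruct i; simpl; intros Hf Hg; apply (is_derive_plus _ _ _ _ _ Hf Hg). Qed.

Lemma is_pd_mult i f g p l m : is_pd i f p l -> is_pd i g p m ->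
  is_pd i (fun q => f q * g q) p (l * g p + f p * m).
Proof.
destruct p as [x y], i; simpl; intros Hf Hg;
  apply (is_derive_mult _ _ _ _ _ Hf Hg); intros; apply Rmult_comm.
Qed.

Lemma is_pd_comp i phi f p l m : is_derive phi (f p) m -> is_pd i f p l ->
  is_pd i (fun q => phi (f q)) p (m * l).
Proof.
destruct p as [x y], i; simpl; intros Hf Hg; rewrite Rmult_comm;
  apply (is_derive_comp phi _ _ _ _ Hf Hg).
Qed.

Lemma locally_slice i (P : pt -> Prop) p : locally p P ->
  match i with
  | i1 => locally (fst p) (fun x => P (x, snd p))
  | i2 => locally (snd p) (fun y => P (fst p, y))
  end.
Proof.
intros [e He]; destruct i; exists e; intros z Hz; apply He; split; simpl; auto;
  apply ball_center.
Qed.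

Lemma pd_ext i (U : pt -> Prop) f g p : open U -> U p ->
  (forall q, U q -> f q = g q) -> pd i f p = pd i g p.
Proof.
intros HU Up E; pose proof (locally_slice i U p (HU p Up)) as HL.
destruct i; simpl in *; apply Derive_ext_loc;
  revert HL; apply filter_imp; auto.
Qed.

Lemma continuous_2d (f : pt -> R) p : continuous f p <->
  continuity_2d_pt (fun x y => f (x, y)) (fst p) (snd p).
Proof.
destruct p as [x y]; rewrite continuity_2d_pt_filterlim; simpl.
split; apply filterlim_ext; now intros [u v].
Qed.

Lemma smooth_on_continuous U f p : smooth_on U f -> U p -> continuous f p.
Proof. intros Hf Up; apply continuous_2d, (Hf 0%nat p Up). Qed.

Lemma smooth_on_is_pd U f p i : smooth_on U f -> U p -> is_pd i f p (pd i f p).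
Proof.
intros Hf Up; destruct (Hf 1%nat p Up) as [_ [H1 [H2 _]]].
destruct i; apply Derive_correct; assumption.
Qed.

Lemma smooth_on_pd U f i : smooth_on U f -> smooth_on U (pd i f).
Proof.
intros Hf n p Up; destruct (Hf (S n) p Up) as [_ [_ [_ [H1 H2]]]].
destruct i; assumption.
Qed.

Lemma smooth_on_ext (U : pt -> Prop) f g : open U ->
  (forall p, U p -> f p = g p) -> smooth_on U f -> smooth_on U g.
Proof.
intros HU E Hf n [x y] Up; simpl.
apply ex_diff_n_ext_loc with (2 := Hf n (x, y) Up).
apply locally_2d_locally; generalize (HU _ Up); apply filter_imp.
intros [u v] H; apply E, H.
Qed.

(** Induction on the order of differentiation, for all members of [P] at once. Openness of [U] makes
    the partial derivatives agree with members of [P] near the point, which is what [ex_diff_n]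
    depends on. *)
Lemma smooth_on_coind (U : pt -> Prop) (P : (pt -> R) -> Prop) : open U ->
  (forall h, P h -> (forall p, U p -> continuous h p) /\
     forall i, exists h', P h' /\ forall p, U p -> is_pd i h p (h' p)) ->
  forall h, P h -> smooth_on U h.
Proof.
intros HU HP h Ph n; revert h Ph; induction n as [|n IH]; intros h Ph p Up;
  destruct (HP h Ph) as [Hc Hd].
  split; [|exact I]; apply continuous_2d; auto.
destruct (Hd i1) as [d1 [P1 D1]], (Hd i2) as [d2 [P2 D2]].
split; [apply continuous_2d; auto|].
split; [exists (d1 p); apply (D1 p Up)|].
split; [exists (d2 p); apply (D2 p Up)|].
split;
  [apply ex_diff_n_ext_loc with (fun u v => d1 (u, v)); [|now apply IH]
  |apply ex_diff_n_ext_loc with (fun u v => d2 (u, v)); [|now apply IH]];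
  apply locally_2d_locally; destruct p as [x y]; generalize (HU _ Up);
  apply filter_imp; intros [u v] H; symmetry; apply is_derive_unique.
  apply (D1 _ H).
apply (D2 _ H).
Qed.

(** The chain rule turns a composition into a product of another composition and a derivative, so
    compositions are handled together with products; one closure under all operations settles every
    rule by a single coinduction. *)
Inductive smooth_closure (U : pt -> Prop) : (pt -> R) -> Prop :=
| closure_base f : smooth_on U f -> smooth_closure U f
| closure_const c : smooth_closure U (fun _ => c)
| closure_coord i : smooth_closure U (coord i)
| closure_plus f g : smooth_closure U f -> smooth_closure U g ->
    smooth_closure U (fun p => f p + g p)
| closure_mult f g : smooth_closure U f -> smooth_closure U g ->
    smooth_closure U (fun p => f p * g p)
| closure_comp D phi f : smooth1 D phi -> (forall p, U p -> D (f p)) ->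
    smooth_closure U f -> smooth_closure U (fun p => phi (f p)).

Lemma smooth_closure_continuous U h p : smooth_closure U h -> U p -> continuous h p.
Proof.
intros Hh Up; induction Hh as [f Hf|c|i|f g _ Hf _ Hg|f g _ Hf _ Hg|D phi f Hphi HD _ Hf].
- apply (smooth_on_continuous U); assumption.
- apply continuous_const.
- destruct i; [apply continuous_fst|apply continuous_snd].
- apply (continuous_plus f g); assumption.
- apply (continuous_mult f g); assumption.
- apply (continuous_comp f phi); [assumption|].
  destruct (smooth1_derive D phi Hphi) as [phi' [_ H]].
  apply (ex_derive_continuous phi); exists (phi' (f p)); auto.
Qed.

Lemma smooth_closure_pd U h i : smooth_closure U h ->
  exists h', smooth_closure U h' /\ forall p, U p -> is_pd i h p (h' p).
Proof.
intros Hh; induction Hh as [f Hf|c|j|f g Hf [f' [Pf Df]] Hg [g' [Pg Dg]]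
  |f g Hf [f' [Pf Df]] Hg [g' [Pg Dg]]|D phi f Hphi HD Hf [f' [Pf Df]]].
- exists (pd i f); split; [constructor; now apply smooth_on_pd|].
  intros p; now apply smooth_on_is_pd.
- exists (fun _ => 0); split; [apply closure_const|]; intros; apply is_pd_const.
- exists (fun _ => kronecker i j); split; [apply closure_const|]; intros; apply is_pd_coord.
- exists (fun p => f' p + g' p); split; [now apply closure_plus|].
  intros; apply is_pd_plus; auto.
- exists (fun p => f' p * g p + f p * g' p); split;
    [now apply closure_plus; apply closure_mult|].
  intros; apply is_pd_mult; auto.
- destruct (smooth1_derive D phi Hphi) as [phi' [Hphi' H]].
  exists (fun p => phi' (f p) * f' p); split.
    apply closure_mult; [apply (closure_comp U D phi' f)|]; auto.
  intros; apply is_pd_comp; auto.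
Qed.

Lemma smooth_closure_smooth U h : open U -> smooth_closure U h -> smooth_on U h.
Proof.
intros HU; apply smooth_on_coind; [assumption|]; intros f Hf; split.
  intros p; now apply smooth_closure_continuous.
intros i; now apply smooth_closure_pd.
Qed.

Section Closure.
Variables (U : pt -> Prop) (HU : open U).

Lemma smooth_const c : smooth_on U (fun _ => c).
Proof. apply smooth_closure_smooth; [assumption|apply closure_const]. Qed.

Lemma smooth_coord i : smooth_on U (coord i).
Proof. apply smooth_closure_smooth; [assumption|apply closure_coord]. Qed.

Lemma smooth_plus f g : smooth_on U f -> smooth_on U g ->
  smooth_on U (fun p => f p + g p).
Proof.
intros; apply smooth_closure_smooth; [assumption|]; now apply closure_plus; apply closure_base.
Qed.

Lemma smooth_mult f g : smooth_on U f -> smooth_on U g ->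
  smooth_on U (fun p => f p * g p).
Proof.
intros; apply smooth_closure_smooth; [assumption|]; now apply closure_mult; apply closure_base.
Qed.

Lemma smooth_comp D phi f : smooth1 D phi -> (forall p, U p -> D (f p)) ->
  smooth_on U f -> smooth_on U (fun p => phi (f p)).
Proof.
intros; apply smooth_closure_smooth; [assumption|].
now apply closure_comp with D; [..|apply closure_base].
Qed.

Lemma smooth_opp f : smooth_on U f -> smooth_on U (fun p => - f p).
Proof.
intros Hf; apply smooth_on_ext with (fun p => -1 * f p); [assumption| |].
  intros; ring.
apply smooth_mult; [apply smooth_const|assumption].
Qed.

Lemma smooth_minus f g : smooth_on U f -> smooth_on U g ->
  smooth_on U (fun p => f p - g p).
Proof. intros; apply smooth_plus; [|apply smooth_opp]; assumption. Qed.

Lemma smooth_div f g : smooth_on U f -> smooth_on U g ->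
  (forall p, U p -> g p <> 0) -> smooth_on U (fun p => f p / g p).
Proof.
intros Hf Hg H; apply smooth_mult; [assumption|].
now apply smooth_comp with (1 := smooth1_inv).
Qed.

Lemma smooth_sum2 F : (forall i, smooth_on U (F i)) ->
  smooth_on U (fun p => sum2 (fun i => F i p)).
Proof. intros H; unfold sum2; apply smooth_plus; apply H. Qed.

Section Metric.
Variables (g : metric) (Hg : riemannian U g).

Lemma riemannian_detg_pos p : U p -> 0 < detg g p.
Proof.
destruct Hg as [_ [_ [Hs Hp]]]; intros Up; unfold detg.
specialize (Hs p Up); specialize (Hp p Up).
assert (P1 := Hp (fun i => match i with i1 => 1 | i2 => 0 end)
  (ex_intro _ i1 R1_neq_R0)).
unfold sum2 in *; cbv beta iota in P1.
(* The vector (- g12, g11) is orthogonal to d_1, and its squared length is g11 times the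
   determinant. *)
assert (P2 := Hp (fun i => match i with i1 => - g i1 i2 p | i2 => g i1 i1 p end)).
cbv beta iota in P2; rewrite <- Hs in *.
assert (P3 : 0 < g i1 i1 p * (g i1 i1 p * g i2 i2 p - g i1 i2 p * g i1 i2 p)).
  replace (g i1 i1 p * (_ - _)) with
    (g i1 i1 p * - g i1 i2 p * - g i1 i2 p + g i1 i2 p * - g i1 i2 p * g i1 i1 p
    + (g i1 i2 p * g i1 i1 p * - g i1 i2 p + g i2 i2 p * g i1 i1 p * g i1 i1 p)) by ring.
  apply P2; exists i2; lra.
apply Rmult_lt_reg_l with (g i1 i1 p); lra.
Qed.

Lemma smooth_detg : smooth_on U (detg g).
Proof.
destruct Hg as [_ [H _]].
apply smooth_minus; apply smooth_mult; apply H.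
Qed.

Lemma smooth_ginv i j : smooth_on U (ginv g i j).
Proof.
assert (H := proj1 (proj2 Hg)); assert (H' := smooth_detg).
assert (N : forall p, U p -> detg g p <> 0).
  intros p Up; apply Rgt_not_eq, riemannian_detg_pos, Up.
destruct i, j; unfold ginv; apply smooth_div; auto; now apply smooth_opp.
Qed.

Lemma smooth_christoffel k i j : smooth_on U (christoffel g k i j).
Proof.
assert (H := proj1 (proj2 Hg)).
apply smooth_mult; [apply smooth_const|].
apply (smooth_sum2 (fun l p =>
    ginv g k l p * (pd i (g j l) p + pd j (g i l) p - pd l (g i j) p))).
intros l; apply smooth_mult; [apply smooth_ginv|].
apply smooth_minus; [apply smooth_plus|]; now apply smooth_on_pd.
Qed.

Lemma smooth_riem l k i j : smooth_on U (riem g l k i j).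
Proof.
apply smooth_plus; [apply smooth_minus|].
- apply smooth_on_pd, smooth_christoffel.
- apply smooth_on_pd, smooth_christoffel.
- apply (smooth_sum2 (fun m p => christoffel g l i m p * christoffel g m j k p
                   - christoffel g l j m p * christoffel g m i k p)).
  intros m; apply smooth_minus; apply smooth_mult; apply smooth_christoffel.
Qed.

Lemma smooth_ricci j k : smooth_on U (ricci g j k).
Proof. apply (smooth_sum2 (fun i => riem g i k i j)); intros; apply smooth_riem. Qed.

Lemma smooth_curvature : smooth_on U (curvature g).
Proof.
apply smooth_div.
- apply (smooth_sum2 (fun l p => g i1 l p * riem g l i2 i1 i2 p)).
  intros l; apply smooth_mult; [apply (proj1 (proj2 Hg))|apply smooth_riem].
- apply smooth_detg.
- intros p Up; apply Rgt_not_eq, riemannian_detg_pos, Up.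
Qed.

Lemma smooth_lie_metric X i j : (forall k, smooth_on U (X k)) ->
  smooth_on U (lie_metric X g i j).
Proof.
intros HX; apply (smooth_sum2 (fun k p => X k p * pd k (g i j) p
                 + g k j p * pd i (X k) p + g i k p * pd j (X k) p)).
assert (H := proj1 (proj2 Hg)).
intros k; repeat apply smooth_plus; apply smooth_mult; auto using smooth_on_pd.
Qed.

End Metric.
End Closure.

Lemma smooth_on_schwarz (U : pt -> Prop) f p : open U -> smooth_on U f -> U p ->
  pd i1 (pd i2 f) p = pd i2 (pd i1 f) p.
Proof.
intros HU Hf Up; destruct p as [x y].
apply (Schwarz (fun u v => f (u, v)) x y).
- apply locally_2d_locally; generalize (HU _ Up); apply filter_imp.
  intros [u v] H; simpl.
  destruct (Hf 2%nat _ H) as [_ [H1 [H2 [H3 H4]]]]; simpl in *; tauto.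
- destruct (Hf 2%nat _ Up) as [_ [H1 [H2 [H3 H4]]]]; simpl in *; tauto.
- destruct (Hf 2%nat _ Up) as [_ [H1 [H2 [H3 H4]]]]; simpl in *; tauto.
Qed.

(** * Curvature of the pullback of the hyperbolic metric *)

Lemma is_pd_div i f h p l m : is_pd i f p l -> is_pd i h p m -> h p <> 0 ->
  is_pd i (fun q => f q / h q) p ((l * h p - f p * m) / h p ^ 2).
Proof.
intros Hf Hh H.
replace ((l * h p - f p * m) / h p ^ 2)
  with (l * / h p + f p * ((- / h p ^ 2) * m)) by (field; assumption).
apply is_pd_mult; [assumption|].
apply (is_pd_comp i Rinv h); [|assumption].
auto_derive; [assumption|field; assumption].
Qed.

(** Lowering the index cancels the inverse metric and leaves the symbols of the first kind, which
    involve no division by the determinant. *)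
Lemma christoffel_lower g m i j p : detg g p <> 0 -> g i1 i2 p = g i2 i1 p ->
  sum2 (fun k => g m k p * christoffel g k i j p)
  = / 2 * (pd i (g j m) p + pd j (g i m) p - pd m (g i j) p).
Proof.
unfold detg; intros Hd Hs.
destruct m; unfold sum2, christoffel, sum2, ginv, detg; rewrite Hs in *; field; lra.
Qed.

Section Pullback.
Variables (U : pt -> Prop) (g : metric) (u v : pt -> R) (c : R).
Hypotheses (Hg : riemannian U g) (Hu : smooth_on U u) (Hv : smooth_on U v)
  (Hc : 0 < c) (v_pos : forall p, U p -> 0 < v p)
  (Eg : forall p, U p -> forall i j,
    g i j p = (pd i u p * pd j u p + pd i v p * pd j v p) / (c * v p ^ 2)).

Let HU : open U := proj1 Hg.
Let J p := pd i1 u p * pd i2 v p - pd i2 u p * pd i1 v p.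

Lemma pullback_detg p : U p -> detg g p = J p ^ 2 / (c ^ 2 * v p ^ 4).
Proof.
intros Up; unfold detg; rewrite !Eg by assumption; unfold J.
specialize (v_pos p Up); field; lra.
Qed.

Lemma pullback_jacobian_neq0 p : U p -> J p <> 0.
Proof.
intros Up HJ; pose proof (riemannian_detg_pos U g Hg p Up) as H.
rewrite pullback_detg in H by assumption; rewrite HJ in H.
unfold Rdiv in H; simpl in H; lra.
Qed.

Lemma pullback_pd_metric l i j p : U p -> pd l (g i j) p =
  (pd l (pd i u) p * pd j u p + pd i u p * pd l (pd j u) p
   + (pd l (pd i v) p * pd j v p + pd i v p * pd l (pd j v) p)) / (c * v p ^ 2)
  - 2 * pd l v p * (pd i u p * pd j u p + pd i v p * pd j v p) / (c * v p ^ 3).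
Proof.
intros Up; rewrite (pd_ext l U _ _ p HU Up (fun q Hq => Eg q Hq i j)).
specialize (v_pos p Up).
assert (D : forall k w, smooth_on U w -> is_pd l (pd k w) p (pd l (pd k w) p)).
  intros k w Hw; apply (smooth_on_is_pd U); [apply smooth_on_pd|]; assumption.
assert (Dv := smooth_on_is_pd U v p l Hv Up).
etransitivity.
  apply is_pd_unique.
  apply (is_pd_div l (fun q => pd i u q * pd j u q + pd i v q * pd j v q)
    (fun q => c * (v q * (v q * 1)))).
  - apply is_pd_plus; apply is_pd_mult; apply D; assumption.
  - apply is_pd_mult; [apply is_pd_const|].
    apply is_pd_mult; [exact Dv|apply is_pd_mult; [exact Dv|apply is_pd_const]].
  - apply Rgt_not_eq; repeat apply Rmult_lt_0_compat; lra.
cbv beta; field; lra.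
Qed.

Let A i j p := (pd i u p * pd j v p + pd j u p * pd i v p) / v p.
Let B i j p := (pd i v p * pd j v p - pd i u p * pd j u p) / v p.

(* The map [(u, v)] is totally geodesic, written with the Christoffel symbols
   of the upper half plane on the right. *)
Lemma pullback_hessian i j p : U p ->
  pd i (pd j u) p = sum2 (fun k => christoffel g k i j p * pd k u p) + A i j p /\
  pd i (pd j v) p = sum2 (fun k => christoffel g k i j p * pd k v p) + B i j p.
Proof.
intros Up.
assert (Hd := Rgt_not_eq _ _ (riemannian_detg_pos U g Hg p Up)).
assert (Hs : g i1 i2 p = g i2 i1 p) by (rewrite !Eg by assumption; lra).
assert (L := fun m => christoffel_lower g m i j p Hd Hs).
assert (HJ := pullback_jacobian_neq0 p Up).
pose proof (v_pos p Up) as Hvp.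
assert (Su : forall a b, pd a (pd b u) p = pd b (pd a u) p).
  pose proof (smooth_on_schwarz U u p HU Hu Up).
  intros [|] [|]; congruence.
assert (Sv : forall a b, pd a (pd b v) p = pd b (pd a v) p).
  pose proof (smooth_on_schwarz U v p HU Hv Up).
  intros [|] [|]; congruence.
(* [P] and [Q] are the defects of the two equations. [K] says that the transposed Jacobian matrix of
   (u, v) kills the vector (P, Q), which then vanishes since [J p <> 0]. *)
set (P := sum2 (fun k => christoffel g k i j p * pd k u p) + A i j p
  - pd i (pd j u) p).
set (Q := sum2 (fun k => christoffel g k i j p * pd k v p) + B i j p
  - pd i (pd j v) p).
assert (K : forall m, P * pd m u p + Q * pd m v p = 0).
  intros m; transitivity
    (c * v p ^ 2 * sum2 (fun k => g m k p * christoffel g k i j p)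
     + (A i j p - pd i (pd j u) p) * pd m u p
     + (B i j p - pd i (pd j v) p) * pd m v p).
    unfold P, Q, sum2; rewrite !Eg by assumption; field; lra.
  (* Everything is now expressed by derivatives of [u] and [v]; once the mixed second derivatives
     are put in a common order, they cancel. *)
  rewrite (L m), !pullback_pd_metric by assumption; unfold A, B.
  rewrite (Su m i), (Su m j), (Su j i), (Sv m i), (Sv m j), (Sv j i).
  field; lra.
assert (K1 := K i1); assert (K2 := K i2).
assert (P * J p = 0).
  unfold J; replace (P * _) with ((P * pd i1 u p + Q * pd i1 v p) * pd i2 v p
    - (P * pd i2 u p + Q * pd i2 v p) * pd i1 v p) by ring.
  rewrite K1, K2; ring.
assert (Q * J p = 0).
  unfold J; replace (Q * _) with ((P * pd i2 u p + Q * pd i2 v p) * pd i1 u p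
    - (P * pd i1 u p + Q * pd i1 v p) * pd i2 u p) by ring.
  rewrite K1, K2; ring.
assert (P = 0) by (destruct (Rmult_integral _ _ H); tauto).
assert (Q = 0) by (destruct (Rmult_integral _ _ H0); tauto).
unfold P, Q in *; lra.
Qed.

(* Compares the mixed third derivatives of [w] computed from its Hessian. *)
Lemma riem_from_hessian w (W : idx -> idx -> pt -> R) p : U p -> smooth_on U w ->
  (forall i j q, U q -> pd i (pd j w) q
     = sum2 (fun k => christoffel g k i j q * pd k w q) + W i j q) ->
  (forall i j, smooth_on U (W i j)) ->
  sum2 (fun m => riem g m i2 i1 i2 p * pd m w p) =
  pd i2 (W i1 i2) p - pd i1 (W i2 i2) p
  + sum2 (fun k => christoffel g k i1 i2 p * W i2 k p
                   - christoffel g k i2 i2 p * W i1 k p).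
Proof.
intros Up Hw EW HW.
assert (D : forall l i j, pd l (pd i (pd j w)) p =
  sum2 (fun k => pd l (christoffel g k i j) p * pd k w p
    + christoffel g k i j p * pd l (pd k w) p) + pd l (W i j) p).
  intros l i j; rewrite (pd_ext l U _ _ p HU Up (EW i j)).
  assert (DG : forall k, is_pd l (christoffel g k i j) p (pd l (christoffel g k i j) p)).
    intros k; apply (smooth_on_is_pd U); [now apply smooth_christoffel|assumption].
  assert (Dw : forall k, is_pd l (pd k w) p (pd l (pd k w) p)).
    intros k; apply (smooth_on_is_pd U); [now apply smooth_on_pd|assumption].
  apply is_pd_unique, is_pd_plus; [apply is_pd_plus; now apply is_pd_mult|].
  now apply (smooth_on_is_pd U).
assert (S := smooth_on_schwarz U (pd i2 w) p HU (smooth_on_pd U w i2 Hw) Up).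
rewrite !D in S; unfold sum2 in S; rewrite !EW in S by assumption.
unfold riem; unfold sum2 in *; lra.
Qed.

(** [riem_from_hessian], applied to [u] and to [v], gives the image of R(d_1, d_2) d_2 under the
    differential: it is J / v^2 times (- d_2 v, d_2 u), as in curvature -1. Its product with the
    image of d_1 is - J^2 / (c v^4), and division by det g = J^2 / (c^2 v^4) leaves - c. *)
Lemma pullback_curvature p : U p -> curvature g p = - c.
Proof.
intros Up; pose proof (v_pos p Up) as Hvp.
assert (N : forall q, U q -> v q <> 0) by (intros q Uq; apply Rgt_not_eq, v_pos, Uq).
assert (Sp : forall i w, smooth_on U w -> smooth_on U (pd i w)).
  intros; now apply smooth_on_pd.
assert (D : forall l k w, smooth_on U w -> is_pd l (pd k w) p (pd l (pd k w) p)).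
  intros l k w Hw; apply (smooth_on_is_pd U); auto.
assert (Dv := fun l => smooth_on_is_pd U v p l Hv Up).
assert (SA : forall i j, smooth_on U (A i j)).
  intros i j; apply smooth_div; trivial.
  apply smooth_plus; trivial; apply smooth_mult; auto.
assert (SB : forall i j, smooth_on U (B i j)).
  intros i j; apply smooth_div; trivial.
  apply smooth_minus; trivial; apply smooth_mult; auto.
assert (DA : forall l i j, pd l (A i j) p =
   ((pd l (pd i u) p * pd j v p + pd i u p * pd l (pd j v) p
   + (pd l (pd j u) p * pd i v p + pd j u p * pd l (pd i v) p)) * v p
   - (pd i u p * pd j v p + pd j u p * pd i v p) * pd l v p) / v p ^ 2).
  intros l i j; apply is_pd_unique.
  apply (is_pd_div l (fun q => pd i u q * pd j v q + pd j u q * pd i v q)); auto.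
  apply is_pd_plus; apply is_pd_mult; auto.
assert (DB : forall l i j, pd l (B i j) p =
   ((pd l (pd i v) p * pd j v p + pd i v p * pd l (pd j v) p
   + -1 * (pd l (pd i u) p * pd j u p + pd i u p * pd l (pd j u) p)) * v p
   - (pd i v p * pd j v p + -1 * (pd i u p * pd j u p)) * pd l v p) / v p ^ 2).
  intros l i j; etransitivity.
    apply (pd_ext l U) with (g := fun q =>
      (pd i v q * pd j v q + -1 * (pd i u q * pd j u q)) / v q); trivial.
    intros q _; unfold B; f_equal; ring.
  apply is_pd_unique.
  apply (is_pd_div l (fun q => pd i v q * pd j v q + -1 * (pd i u q * pd j u q))); auto.
  apply is_pd_plus; [apply is_pd_mult; auto|].
  replace (-1 * (pd l (pd i u) p * pd j u p + pd i u p * pd l (pd j u) p)) with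
   (0 * (pd i u p * pd j u p)
    + -1 * (pd l (pd i u) p * pd j u p + pd i u p * pd l (pd j u) p)) by ring.
  apply (is_pd_mult l (fun _ => -1) (fun q => pd i u q * pd j u q));
    [apply is_pd_const|apply is_pd_mult; auto].
assert (Ru := riem_from_hessian u A p Up Hu
  (fun i j q Uq => proj1 (pullback_hessian i j q Uq)) SA).
assert (Rv := riem_from_hessian v B p Up Hv
  (fun i j q Uq => proj2 (pullback_hessian i j q Uq)) SB).
rewrite !DA in Ru; rewrite !DB in Rv.
assert (Eu := fun i j => proj1 (pullback_hessian i j p Up)).
assert (Ev := fun i j => proj2 (pullback_hessian i j p Up)).
(* With a single order for mixed derivatives, the Hessian equations remove all second derivatives,
   and the Christoffel symbols they introduce cancel against those already present. *)
rewrite <- (smooth_on_schwarz U u p HU Hu Up), <- (smooth_on_schwarz U v p HU Hv Up),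
  !Eu, !Ev in Ru, Rv.
assert (Ru' : sum2 (fun m => riem g m i2 i1 i2 p * pd m u p)
  = - pd i2 v p * J p / v p ^ 2).
  rewrite Ru; unfold A, B, J, sum2.
  field; lra.
assert (Rv' : sum2 (fun m => riem g m i2 i1 i2 p * pd m v p)
  = pd i2 u p * J p / v p ^ 2).
  rewrite Rv; unfold A, B, J, sum2; field; lra.
clear Ru Rv.
assert (HJ := pullback_jacobian_neq0 p Up).
unfold curvature; rewrite pullback_detg by assumption.
replace (sum2 (fun l => g i1 l p * riem g l i2 i1 i2 p)) with
  ((pd i1 u p * sum2 (fun m => riem g m i2 i1 i2 p * pd m u p)
   + pd i1 v p * sum2 (fun m => riem g m i2 i1 i2 p * pd m v p)) / (c * v p ^ 2)).
  2: unfold sum2; rewrite !Eg by assumption; field; lra.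
rewrite Ru', Rv'.
transitivity (- J p * J p / (c * v p ^ 4) / (J p ^ 2 / (c ^ 2 * v p ^ 4))).
  f_equal; unfold J; field; lra.
field; repeat split; trivial; lra.
Qed.

End Pullback.

Lemma isometric_hyperbolic_curvature (U : pt -> Prop) g : riemannian U g ->
  isometric_up_to_scaling U g upper_half_plane hyperbolic_metric ->
  exists K, forall p, U p -> curvature g p = K.
Proof.
intros Hg [c [Hc [phi [psi [[Hphi _] [Sphi [_ E]]]]]]].
(* The scaled metric [c g] has curvature -1, and scaling a metric by [c] divides its curvature by
   [c]. *)
exists (- c); intros p Up.
assert (Hv : forall q, U q -> 0 < coord i2 (phi q)) by (intros q Uq; apply (Hphi q Uq)).
apply (pullback_curvature U g (fun q => coord i1 (phi q)) (fun q => coord i2 (phi q)));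
  trivial.
intros q Uq i j; specialize (Hv q Uq).
apply Rmult_eq_reg_l with c; [|lra].
rewrite <- (E q Uq i j).
unfold pullback, sum2, hyperbolic_metric, diag_metric; simpl coord in *.
field; lra.
Qed.

(** * The metric [G a] on the half-plane *)

(** [a' = 4 mu a^2 (a / gamma - 1)] with [gamma = 2 mu / lam], expanded. *)
Definition soliton_ode (lam mu : R) (a : R -> R) : Prop :=
  forall t, 0 < t ->
    0 < a t /\ is_derive a t (2 * lam * a t ^ 3 - 4 * mu * a t ^ 2).

Lemma smooth1_soliton_ode lam mu D a h :
  (forall t, D t -> is_derive a t (2 * lam * a t ^ 3 - 4 * mu * a t ^ 2)) ->
  polynomial_in a h -> smooth1 D h.
Proof.
intros Ha; apply (smooth1_ode _ a
  (fun t => (2 * lam) * (a t * (a t * a t)) + (-4 * mu) * (a t * a t))).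
  apply polynomial_plus; repeat apply polynomial_mult; constructor.
intros t Ht.
replace (_ + _) with (2 * lam * a t ^ 3 - 4 * mu * a t ^ 2) by ring; exact (Ha t Ht).
Qed.

Lemma open_half_plane : open half_plane.
Proof.
apply (open_comp (fst : pt -> R) (fun x => 0 < x)); [|apply open_gt].
intros p _; apply continuous_fst.
Qed.

Section HalfPlane.
Variables (lam mu : R) (a : R -> R) (g : metric).
Hypotheses (Ha : soliton_ode lam mu a)
  (Eg : forall p, half_plane p -> forall i j, g i j p = G a i j p).

Lemma G_smooth i j : smooth_on half_plane (G a i j).
Proof.
assert (HU := open_half_plane).
assert (H1 : smooth_on half_plane fst) by (apply (smooth_coord _ HU i1)).
assert (N : forall p, half_plane p -> fst p <> 0) by (unfold half_plane; intros; lra).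
destruct i, j; simpl.
- apply smooth_div; trivial.
  apply smooth_on_ext with (fun p => (fun t => a t * a t) (fst p)); trivial.
    intros; simpl; ring.
  apply (smooth_comp _ HU (fun t => 0 < t) (fun t => a t * a t) fst); trivial.
  apply (smooth1_soliton_ode lam mu _ a); [apply Ha|].
  apply polynomial_mult; constructor.
- now apply smooth_const.
- now apply smooth_const.
- apply smooth_mult; trivial; now apply smooth_const.
Qed.

(** Stated, like the following lemmas, for any [g] that agrees with [G a] on the half-plane: the
    metric of the cover is [pullback polar g], for which agreement is known only there. *)
Lemma G_riemannian : riemannian half_plane g.
Proof.
split; [apply open_half_plane|split; [|split]].
- intros i j; apply smooth_on_ext with (G a i j); [apply open_half_plane| |apply G_smooth].
  intros; now rewrite Eg.
- intros p Up; now rewrite !Eg.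
- intros p Up v [i Hi]; unfold sum2; rewrite !Eg by assumption; simpl.
  unfold half_plane in Up; destruct (Ha _ Up) as [Hp _].
  assert (0 < a (fst p) * (a (fst p) * 1) / fst p).
    apply Rdiv_lt_0_compat; [nra|assumption].
  assert (Q : forall x, x <> 0 -> 0 < x * x).
    intros x Hx; destruct (Rtotal_order x 0) as [|[|]]; [|contradiction|]; nra.
  pose proof (Rle_0_sqr (v i1)); pose proof (Rle_0_sqr (v i2)); unfold Rsqr in *.
  destruct i; specialize (Q _ Hi); nra.
Qed.

Lemma G_pd l i j p : half_plane p -> pd l (g i j) p =
  match l, i, j with
  | i1, i1, i1 => (2 * a (fst p) * (2 * lam * a (fst p) ^ 3 - 4 * mu * a (fst p) ^ 2)
                   * fst p - a (fst p) ^ 2) / fst p ^ 2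
  | i1, i2, i2 => 4
  | _, _, _ => 0
  end.
Proof.
intros Up; rewrite (pd_ext l half_plane _ (G a i j) p open_half_plane Up)
  by (intros; now apply Eg).
unfold half_plane in Up; destruct (Ha _ Up) as [Hp Da].
destruct l, i, j; apply is_pd_unique; simpl;
  try (auto_derive; trivial; ring).
assert (ED : Derive (fun x => a x) (fst p) = 2 * lam * a (fst p) ^ 3 - 4 * mu * a (fst p) ^ 2)
  by (apply is_derive_unique, Da).
assert (Ex : ex_derive (fun x => a x) (fst p)) by (eexists; exact Da).
auto_derive; [repeat split; trivial; lra|rewrite ED; field; lra].
Qed.

(** Christoffel symbols of [G a], with a' / a replaced by 2 lam a^2 - 4 mu a. *)
Let Gam k i j t :=
  match k, i, j with
  | i1, i1, i1 => 2 * lam * a t ^ 2 - 4 * mu * a t - / (2 * t)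
  | i1, i2, i2 => - (2 * t / a t ^ 2)
  | i2, i1, i2 | i2, i2, i1 => / (2 * t)
  | _, _, _ => 0
  end.

Lemma G_christoffel k i j p : half_plane p -> christoffel g k i j p = Gam k i j (fst p).
Proof.
intros Up; unfold christoffel, sum2, ginv, detg; rewrite !G_pd, !Eg by assumption.
unfold half_plane in Up; destruct (Ha _ Up) as [Hp Da].
destruct k, i, j; simpl; field; lra.
Qed.

Lemma G_pd_christoffel l k i j p : half_plane p -> pd l (christoffel g k i j) p =
  let t := fst p in let a' := 2 * lam * a t ^ 3 - 4 * mu * a t ^ 2 in
  match l, k, i, j with
  | i1, i1, i1, i1 => 4 * lam * a t * a' - 4 * mu * a' + / (2 * t ^ 2)
  | i1, i1, i2, i2 => - (2 / a t ^ 2 - 4 * t * a' / a t ^ 3)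
  | i1, i2, i1, i2 | i1, i2, i2, i1 => - / (2 * t ^ 2)
  | _, _, _, _ => 0
  end.
Proof.
intros Up; rewrite (pd_ext l half_plane _ (fun q : pt => Gam k i j (fst q)) p
  open_half_plane Up) by (intros; now apply G_christoffel).
unfold half_plane in Up; destruct (Ha _ Up) as [Hp Da].
destruct l; apply is_pd_unique; simpl; [|auto_derive; trivial].
assert (ED : Derive (fun x => a x) (fst p) = 2 * lam * a (fst p) ^ 3 - 4 * mu * a (fst p) ^ 2)
  by (apply is_derive_unique, Da).
assert (Ex : ex_derive (fun x => a x) (fst p)) by (eexists; exact Da).
destruct k, i, j; simpl; auto_derive; trivial;
  repeat split; trivial; try lra; try (rewrite ED; field; lra); try (field; lra).
apply Rgt_not_eq; nra.
Qed.

Lemma G_curvature p : half_plane p -> curvature g p = lam - 2 * mu / a (fst p).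
Proof.
intros Up; unfold curvature, riem, sum2, detg.
rewrite !G_pd_christoffel, !G_christoffel, !Eg by assumption.
unfold half_plane in Up; destruct (Ha _ Up) as [Hp Da].
simpl; field; lra.
Qed.

Lemma G_ricci i j p : half_plane p ->
  ricci g i j p = (lam - 2 * mu / a (fst p)) * g i j p.
Proof.
intros Up; unfold ricci, riem, sum2.
rewrite !G_pd_christoffel, !G_christoffel, !Eg by assumption.
unfold half_plane in Up; destruct (Ha _ Up) as [Hp Da].
destruct i, j; simpl; field; lra.
Qed.

Lemma G_soliton : exists X, ricci_soliton half_plane g X lam.
Proof.
set (X := fun i (p : pt) => match i with i1 => 4 * mu * fst p / a (fst p) | i2 => 0 end : R).
assert (HU := open_half_plane).
exists X; split; [apply G_riemannian|split].
- intros [|]; simpl; [|now apply smooth_const].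
  assert (H1 : smooth_on half_plane fst) by (apply (smooth_coord _ HU i1)).
  apply smooth_div; trivial.
  + apply smooth_mult; trivial; now apply smooth_const.
  + apply (smooth_comp _ HU (fun t => 0 < t) a fst); trivial.
    apply (smooth1_soliton_ode lam mu _ a); [apply Ha|constructor].
  + intros p Up; apply Rgt_not_eq, (Ha _ Up).
- intros p Up i j; rewrite G_ricci by assumption.
  unfold lie_metric, sum2; rewrite !G_pd, !Eg by assumption.
  assert (P := Up); unfold half_plane in P; destruct (Ha _ P) as [Hp Da].
  assert (DX : forall l k, pd l (X k) p = match l, k with
    | i1, i1 => 4 * mu / a (fst p)
      - 4 * mu * fst p * (2 * lam * a (fst p) ^ 3 - 4 * mu * a (fst p) ^ 2) / a (fst p) ^ 2
    | _, _ => 0 end).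
    assert (ED : Derive (fun x => a x) (fst p)
      = 2 * lam * a (fst p) ^ 3 - 4 * mu * a (fst p) ^ 2) by (apply is_derive_unique, Da).
    assert (Ex : ex_derive (fun x => a x) (fst p)) by (eexists; exact Da).
    intros [|] [|]; apply is_pd_unique; simpl; auto_derive; trivial; try ring.
      repeat split; trivial; lra.
    rewrite ED; field; lra.
  rewrite !DX; destruct i, j; simpl; field; lra.
Qed.

End HalfPlane.

(** * The metric in Cartesian coordinates *)

Definition rsq (p : pt) : R := fst p ^ 2 + snd p ^ 2.

Lemma rsq_pos p : punctured_plane p -> 0 < rsq p.
Proof.
destruct p as [x y]; unfold punctured_plane, rsq; simpl; intros N.
destruct (Req_dec x 0) as [->|]; [|nra].
destruct (Req_dec y 0) as [->|]; [now destruct N|nra].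
Qed.

Lemma punctured_plane_rsq p : 0 < rsq p -> punctured_plane p.
Proof. intros H ->; unfold rsq in H; simpl in H; lra. Qed.

Lemma open_punctured_plane : open punctured_plane.
Proof.
apply open_ext with (fun p => 0 < rsq p).
  intros p; split; [apply punctured_plane_rsq|apply rsq_pos].
apply (open_comp rsq (fun x => 0 < x)); [|apply open_gt].
intros p _; apply continuous_2d; unfold rsq; simpl.
apply continuity_2d_pt_plus; repeat apply continuity_2d_pt_mult;
  apply continuity_2d_pt_id1 || apply continuity_2d_pt_id2 || apply continuity_2d_pt_const.
Qed.

Lemma is_pd_rsq i p : is_pd i rsq p (2 * coord i p).
Proof. destruct i; unfold rsq; simpl; auto_derive; trivial; ring. Qed.

Lemma smooth_rsq U : open U -> smooth_on U rsq.
Proof.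
intros HU; apply smooth_on_ext with
  (fun p => coord i1 p * coord i1 p + coord i2 p * coord i2 p); trivial.
  intros; unfold rsq; simpl; ring.
apply smooth_plus; trivial; apply smooth_mult; trivial; now apply smooth_coord.
Qed.

(** The lowered symbols determine the symbols because the metric is nondegenerate; the proof is
    Cramer's rule. A guessed closed form can thus be verified without forming the inverse metric. *)
Lemma christoffel_unique g i j p C : detg g p <> 0 -> g i1 i2 p = g i2 i1 p ->
  (forall m, sum2 (fun k => g m k p * C k)
     = / 2 * (pd i (g j m) p + pd j (g i m) p - pd m (g i j) p)) ->
  forall k, christoffel g k i j p = C k.
Proof.
intros Hd Hs H k.
assert (E1 := christoffel_lower g i1 i j p Hd Hs).
assert (E2 := christoffel_lower g i2 i j p Hd Hs).
rewrite <- H in E1, E2; unfold sum2 in E1, E2; unfold detg in Hd.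
apply Rminus_diag_uniq, Rmult_eq_reg_l with (2 := Hd); rewrite Rmult_0_r.
destruct k; [transitivity
  (g i2 i2 p * (g i1 i1 p * christoffel g i1 i j p + g i1 i2 p * christoffel g i2 i j p
    - (g i1 i1 p * C i1 + g i1 i2 p * C i2))
  - g i1 i2 p * (g i2 i1 p * christoffel g i1 i j p + g i2 i2 p * christoffel g i2 i j p
    - (g i2 i1 p * C i1 + g i2 i2 p * C i2)))
  |transitivity
  (g i1 i1 p * (g i2 i1 p * christoffel g i1 i j p + g i2 i2 p * christoffel g i2 i j p
    - (g i2 i1 p * C i1 + g i2 i2 p * C i2))
  - g i2 i1 p * (g i1 i1 p * christoffel g i1 i j p + g i1 i2 p * christoffel g i2 i j p
    - (g i1 i1 p * C i1 + g i1 i2 p * C i2)))];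
  try ring; rewrite E1, E2; ring.
Qed.

(** This is 4 (dx^2 + dy^2 + k(r^2) (x dx + y dy)^2). Since r dr = x dx + y dy, the choice k(t) =
    (a(t)^2 - 1) / t turns it into 4 (a^2 dr^2 + r^2 dtheta^2), which is G_a for t = r^2. *)
Definition radial_metric (k : R -> R) : metric := fun i j p =>
  4 * (kronecker i j + k (rsq p) * coord i p * coord j p).

Section Radial.
Variables (lam mu : R) (a : R -> R) (g : metric).
Hypotheses (Ha : soliton_ode lam mu a)
  (Eg : forall p, punctured_plane p -> forall i j,
    g i j p = radial_metric (fun t => (a t ^ 2 - 1) / t) i j p).

Let HU := open_punctured_plane.
(* Derivatives are written with [a'] eliminated by the ODE; [A] and [B] are the
   coefficients of [Gamma^l_ij = x_l (A x_i x_j + B delta_ij)]. *)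
Let a' t := 2 * lam * a t ^ 3 - 4 * mu * a t ^ 2.
Let k t := (a t ^ 2 - 1) / t.
Let k' t := (2 * a t * a' t - k t) / t.
Let B t := (1 - / a t ^ 2) / t.
Let A t := (4 * lam * a t ^ 2 - 8 * mu * a t - B t) / t.
Let B' t := (4 * lam - 8 * mu / a t - B t) / t.
Let A' t := ((8 * lam * a t - 8 * mu) * a' t - B' t - A t) / t.

Lemma radial_derivatives t : 0 < t ->
  is_derive k t (k' t) /\ is_derive A t (A' t) /\ is_derive B t (B' t).
Proof.
intros Ht; destruct (Ha t Ht) as [Hp Da].
assert (ED : Derive (fun x => a x) t = 2 * lam * a t ^ 3 - 4 * mu * a t ^ 2)
  by (apply is_derive_unique, Da).
assert (Ex : ex_derive (fun x => a x) t) by (eexists; exact Da).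
assert (a t * (a t * 1) <> 0) by (apply Rgt_not_eq; nra).
split; [|split]; unfold A, B, k; auto_derive;
  try (repeat split; trivial; lra); rewrite ED;
  unfold A', B', k', A, B, k, a'; field; repeat split; trivial; lra.
Qed.

Lemma radial_pd_metric l i j p : punctured_plane p -> pd l (g i j) p =
  4 * (2 * k' (rsq p) * coord l p * coord i p * coord j p
    + k (rsq p) * (kronecker l i * coord j p + kronecker l j * coord i p)).
Proof.
intros Up; rewrite (pd_ext l punctured_plane _ _ p HU Up (fun q Uq => Eg q Uq i j)).
destruct (radial_derivatives (rsq p) (rsq_pos p Up)) as [D _].
etransitivity.
  apply is_pd_unique.
  apply (is_pd_mult l (fun _ => 4)); [apply is_pd_const|].
  apply (is_pd_plus l (fun _ => kronecker i j)); [apply is_pd_const|].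
  apply is_pd_mult; [apply is_pd_mult|]; [|apply is_pd_coord..].
  apply (is_pd_comp l k rsq p (2 * coord l p) (k' (rsq p))); [exact D|apply is_pd_rsq].
unfold k; ring.
Qed.

(** The radial direction is an eigenvector of the metric with eigenvalue 4 (1 + k t) = 4 a^2.
    Lowering the index of a radial vector therefore multiplies by 4 a^2, which relates [A] and [B]
    to [k'] and [k]. *)
Lemma radial_coefficients t : 0 < t ->
  k' t = a t ^ 2 * A t /\ k t = a t ^ 2 * B t /\ 1 + k t * t = a t ^ 2.
Proof.
intros Ht; destruct (Ha t Ht) as [Hp _].
unfold k', A, B, k, a'; repeat split; field; lra.
Qed.

Lemma radial_eq i j p : punctured_plane p ->
  g i j p = 4 * (kronecker i j + k (rsq p) * coord i p * coord j p).
Proof. intros Up; apply (Eg p Up). Qed.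

Lemma radial_detg p : punctured_plane p -> detg g p = 16 * a (rsq p) ^ 2.
Proof.
intros Up; unfold detg; rewrite !radial_eq by assumption.
rewrite <- (proj2 (proj2 (radial_coefficients _ (rsq_pos p Up)))).
generalize (k (rsq p)); intros; unfold rsq; simpl kronecker; simpl coord; ring.
Qed.

Lemma radial_christoffel l i j p : punctured_plane p -> christoffel g l i j p =
  coord l p * (A (rsq p) * coord i p * coord j p + B (rsq p) * kronecker i j).
Proof.
intros Up; assert (Ht := rsq_pos p Up); destruct (Ha _ Ht) as [Hp _].
apply (christoffel_unique g i j p (fun l => coord l p *
  (A (rsq p) * coord i p * coord j p + B (rsq p) * kronecker i j))).
- rewrite radial_detg by assumption; apply Rgt_not_eq; nra.
- rewrite !radial_eq by assumption; simpl kronecker; ring.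
- intros m; rewrite !radial_pd_metric by assumption; unfold sum2.
  rewrite !radial_eq by assumption.
  destruct (radial_coefficients _ Ht) as [E1 [E2 E3]].
  (* The claimed symbols are radial in the upper index, so lowering it only produces the radial
     eigenvalue. *)
  transitivity (4 * coord m p * (1 + k (rsq p) * rsq p) *
    (A (rsq p) * coord i p * coord j p + B (rsq p) * kronecker i j)).
    generalize (A (rsq p)) (B (rsq p)) (k (rsq p)); intros.
    unfold rsq; destruct m; simpl kronecker; simpl coord; ring.
  rewrite E3, E1, E2.
  destruct m, i, j; simpl kronecker; field.
Qed.

Lemma radial_pd_christoffel m l i j p : punctured_plane p ->
  pd m (christoffel g l i j) p =
  kronecker m l * (A (rsq p) * coord i p * coord j p + B (rsq p) * kronecker i j)
  + coord l p * (2 * A' (rsq p) * coord m p * coord i p * coord j p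
     + A (rsq p) * (kronecker m i * coord j p + kronecker m j * coord i p)
     + 2 * B' (rsq p) * coord m p * kronecker i j).
Proof.
intros Up; rewrite (pd_ext m punctured_plane _ _ p HU Up
  (fun q Uq => radial_christoffel l i j q Uq)).
destruct (radial_derivatives (rsq p) (rsq_pos p Up)) as [_ [DA DB]].
etransitivity.
  apply is_pd_unique, is_pd_mult; [apply is_pd_coord|].
  apply is_pd_plus; apply is_pd_mult.
  - apply is_pd_mult; [|apply is_pd_coord].
    apply (is_pd_comp m A rsq); [exact DA|apply is_pd_rsq].
  - apply is_pd_coord.
  - apply (is_pd_comp m B rsq); [exact DB|apply is_pd_rsq].
  - apply (is_pd_const m (kronecker i j)).
cbv beta; ring.
Qed.

Lemma radial_ricci i j p : punctured_plane p ->
  ricci g i j p = (lam - 2 * mu / a (rsq p)) * g i j p.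
Proof.
intros Up; assert (Ht := rsq_pos p Up); destruct (Ha _ Ht) as [Hp _].
(* Rotational symmetry leaves only the tensors delta_ij and x_i x_j. Their coefficients are found
   for arbitrary values of [A], [B], [A'], [B']; the definitions of these functions enter
   afterwards, in [E1] and [E2]. *)
transitivity (kronecker i j * (B (rsq p) + 2 * rsq p * B' (rsq p) - A (rsq p) * rsq p
    + rsq p * B (rsq p) * (A (rsq p) * rsq p + B (rsq p)))
  + coord i p * coord j p * (2 * A (rsq p) - 2 * B' (rsq p)
    - B (rsq p) * (A (rsq p) * rsq p + B (rsq p)))).
  unfold ricci, riem, sum2.
  rewrite !radial_pd_christoffel, !radial_christoffel by assumption.
  generalize (A (rsq p)) (B (rsq p)) (A' (rsq p)) (B' (rsq p)); intros.
  unfold rsq; destruct i, j; simpl kronecker; simpl coord; ring.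
rewrite radial_eq by assumption; unfold k.
generalize dependent (rsq p); intros t Ht Hp.
assert (E1 : B t + 2 * t * B' t - A t * t + t * B t * (A t * t + B t)
  = 4 * (lam - 2 * mu / a t)).
  unfold B', A, B; field; lra.
assert (E2 : 2 * A t - 2 * B' t - B t * (A t * t + B t)
  = 4 * (lam - 2 * mu / a t) * ((a t ^ 2 - 1) / t)).
  unfold B', A, B; field; lra.
rewrite E1, E2; ring.
Qed.

Lemma radial_soliton_equation X p i j : punctured_plane p ->
  (forall l q, punctured_plane q -> X l q = 2 * mu / a (rsq q) * coord l q) ->
  -2 * ricci g i j p = lie_metric X g i j p - 2 * lam * g i j p.
Proof.
intros Up EX; assert (Ht := rsq_pos p Up); destruct (Ha _ Ht) as [Hp Da].
set (f := fun t => 2 * mu / a t); set (f' := fun t => - 2 * mu * a' t / a t ^ 2).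
assert (Df : is_derive f (rsq p) (f' (rsq p))).
  assert (ED : Derive (fun x => a x) (rsq p) = a' (rsq p))
    by (apply is_derive_unique, Da).
  unfold f, f'; auto_derive; [split; [eexists; exact Da|lra]|].
  rewrite ED; field; lra.
assert (DX : forall m l, pd m (X l) p =
  2 * f' (rsq p) * coord m p * coord l p + f (rsq p) * kronecker m l).
  intros m l; rewrite (pd_ext m punctured_plane _ _ p HU Up (EX l)).
  etransitivity.
    apply is_pd_unique, is_pd_mult; [|apply is_pd_coord].
    apply (is_pd_comp m f rsq); [exact Df|apply is_pd_rsq].
  unfold f; ring.
rewrite radial_ricci by assumption; unfold lie_metric, sum2.
rewrite !DX, !radial_pd_metric, !EX, !radial_eq by assumption.
fold (f (rsq p)).
destruct (radial_coefficients _ Ht) as [_ [_ E3]].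
(* Given the Ricci tensor, the soliton equation says that [X] is conformal, with L_X g = 2 f g. The
   difference of the two sides is 8 x_i x_j times the expression shown here to vanish. *)
assert (E : f (rsq p) * rsq p * k' (rsq p) + f (rsq p) * k (rsq p)
  + 2 * f' (rsq p) * (1 + k (rsq p) * rsq p) = 0).
  rewrite E3; unfold f, f', k'; field; lra.
transitivity (2 * f (rsq p) * 4 * (kronecker i j + k (rsq p) * coord i p * coord j p)
  + 8 * coord i p * coord j p * 0
  - 2 * lam * (4 * (kronecker i j + k (rsq p) * coord i p * coord j p))).
  unfold f; field; lra.
rewrite <- E; clear - p.
generalize (f (rsq p)) (f' (rsq p)) (k (rsq p)) (k' (rsq p)); intros.
unfold rsq; destruct i, j; simpl kronecker; simpl coord; ring.
Qed.

End Radial.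

(** In dimension two, antisymmetry of [riem] in its last two indices leaves one term in each trace,
    so the Ricci tensor gives the components of R(d_1, d_2) d_2 directly. *)
Lemma curvature_from_ricci g K p : detg g p <> 0 -> g i1 i2 p = g i2 i1 p ->
  (forall i j, ricci g i j p = K * g i j p) -> curvature g p = K.
Proof.
intros Hd Hs E.
assert (E1 := E i2 i2); assert (E2 := E i1 i2).
unfold ricci, sum2 in E1, E2.
assert (R1 : riem g i1 i2 i1 i2 p = K * g i2 i2 p).
  rewrite <- E1; unfold riem, sum2; ring.
assert (R2 : riem g i2 i2 i1 i2 p = - (K * g i1 i2 p)).
  rewrite <- E2; unfold riem, sum2; ring.
unfold curvature, sum2; rewrite R1, R2; unfold detg in *.
rewrite Hs in *; field; assumption.
Qed.

(** * Passage between polar and Cartesian coordinates *)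

Lemma rsq_polar p : half_plane p -> rsq (polar p) = fst p.
Proof.
intros Hp; unfold half_plane in Hp; unfold rsq, polar; simpl fst; simpl snd.
pose proof (sqrt_sqrt (fst p) ltac:(lra)); pose proof (sin2_cos2 (snd p)).
unfold Rsqr in *.
replace (_ + _) with (sqrt (fst p) * sqrt (fst p) *
  (sin (snd p) * sin (snd p) + cos (snd p) * cos (snd p))) by ring.
rewrite H, H0; ring.
Qed.

Lemma polar_punctured p : half_plane p -> punctured_plane (polar p).
Proof. intros Hp; apply punctured_plane_rsq; rewrite rsq_polar; trivial. Qed.

Lemma unit_circle_angle c s : c ^ 2 + s ^ 2 = 1 ->
  exists th, c = cos th /\ s = sin th.
Proof.
intros H; assert (Hc : -1 <= c <= 1) by nra.
assert (Q : 1 - c² = s²) by (unfold Rsqr; lra).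
destruct (Rle_dec 0 s) as [Hs|Hs].
  exists (acos c); rewrite cos_acos, sin_acos, Q, sqrt_Rsqr by trivial; auto.
exists (- acos c).
rewrite cos_neg, sin_neg, cos_acos, sin_acos, Q, sqrt_Rsqr_abs, Rabs_left by lra.
split; ring.
Qed.

Lemma polar_surjective q : punctured_plane q -> exists p, half_plane p /\ polar p = q.
Proof.
intros Hq; pose proof (rsq_pos q Hq) as Hr; pose proof (sqrt_lt_R0 _ Hr) as Hs.
destruct (unit_circle_angle (fst q / sqrt (rsq q)) (snd q / sqrt (rsq q))) as [th [H1 H2]].
  transitivity (rsq q / (sqrt (rsq q) * sqrt (rsq q))).
    unfold rsq at 3; field; lra.
  rewrite sqrt_sqrt by lra; field; lra.
exists (rsq q, th); split; [exact Hr|]; unfold polar; simpl.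
rewrite <- H1, <- H2; destruct q; simpl; f_equal; field; lra.
Qed.

Lemma pullback_polar g p i j : half_plane p ->
  let t := fst p in let c := cos (snd p) in let s := sin (snd p) in
  let h k l := g k l (polar p) in
  pullback polar g i j p =
  match i, j with
  | i1, i1 => (h i1 i1 * c ^ 2 + (h i1 i2 + h i2 i1) * (c * s) + h i2 i2 * s ^ 2) / (4 * t)
  | i1, i2 => (- h i1 i1 * (c * s) + h i1 i2 * c ^ 2 - h i2 i1 * s ^ 2
               + h i2 i2 * (c * s)) / 2
  | i2, i1 => (- h i1 i1 * (c * s) + h i2 i1 * c ^ 2 - h i1 i2 * s ^ 2
               + h i2 i2 * (c * s)) / 2
  | i2, i2 => t * (h i1 i1 * s ^ 2 - (h i1 i2 + h i2 i1) * (c * s) + h i2 i2 * c ^ 2)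
  end.
Proof.
intros Hp t c s h; unfold half_plane in Hp.
assert (Hs := sqrt_lt_R0 _ Hp); assert (E := sqrt_sqrt (fst p) ltac:(lra)).
assert (D : forall i k, pd i (fun q => coord k (polar q)) p = match i, k with
  | i1, i1 => c / (2 * sqrt t) | i1, i2 => s / (2 * sqrt t)
  | i2, i1 => - sqrt t * s | i2, i2 => sqrt t * c end).
  intros [|] [|]; apply is_pd_unique; simpl; auto_derive; trivial;
    unfold c, s, t; field; lra.
unfold pullback, sum2; rewrite !D; fold (h i1 i1) (h i1 i2) (h i2 i1) (h i2 i2).
fold t in Hs, E.
destruct i, j.
- replace (4 * t) with (4 * (sqrt t * sqrt t)) by (rewrite E; ring); field; lra.
- field; lra.
- field; lra.
- transitivity (sqrt t * sqrt t *
   (h i1 i1 * s ^ 2 - (h i1 i2 + h i2 i1) * (c * s) + h i2 i2 * c ^ 2)); [ring|].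
  now rewrite E.
Qed.

(** At [polar p] the hypothesis gives the matrix of [g] in the orthonormal frame rotated by theta
    ([F1], [F2], [F3]). Rotating back, with (sin^2 + cos^2)^2 = 1, recovers the Cartesian entries;
    surjectivity of [polar] covers all points. *)
Lemma polar_to_radial a g : riemannian punctured_plane g -> is_G_in_polar a g ->
  forall q, punctured_plane q -> forall i j,
    g i j q = radial_metric (fun t => (a t ^ 2 - 1) / t) i j q.
Proof.
intros [_ [_ [Hs _]]] Hg q Hq; destruct (polar_surjective q Hq) as [p [Hp <-]].
specialize (Hs _ (polar_punctured p Hp)).
assert (E1 := Hg p Hp i1 i1); assert (E2 := Hg p Hp i1 i2); assert (E3 := Hg p Hp i2 i2).
rewrite pullback_polar in E1, E2, E3 by assumption; simpl in E1, E2, E3.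
assert (Hcs := sin2_cos2 (snd p)); unfold Rsqr in Hcs.
unfold radial_metric; rewrite rsq_polar by assumption.
unfold half_plane in Hp.
assert (E := sqrt_sqrt (fst p) ltac:(lra)).
set (t := fst p) in *; set (c := cos (snd p)) in *; set (s := sin (snd p)) in *.
set (g11 := g i1 i1 (polar p)) in *; set (g12 := g i1 i2 (polar p)) in *.
set (g22 := g i2 i2 (polar p)) in *; rewrite <- Hs in *.
assert (F1 : g11 * c ^ 2 + 2 * g12 * (c * s) + g22 * s ^ 2 = 4 * a t ^ 2).
  apply Rmult_eq_reg_r with (/ (4 * t)); [|apply Rinv_neq_0_compat; lra].
  transitivity (a t * (a t * 1) / t); [rewrite <- E1; field; lra|field; lra].
assert (F2 : - g11 * (c * s) + g12 * (c ^ 2 - s ^ 2) + g22 * (c * s) = 0) by nra.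
assert (F3 : g11 * s ^ 2 - 2 * g12 * (c * s) + g22 * c ^ 2 = 4).
  apply Rmult_eq_reg_l with t; lra.
assert (G11 : g11 = 4 * (1 + (a t ^ 2 - 1) * c ^ 2)).
  transitivity (g11 * (s * s + c * c) ^ 2); [rewrite Hcs; ring|].
  transitivity (c ^ 2 * (4 * a t ^ 2) - 2 * (c * s) * 0 + s ^ 2 * 4).
    rewrite <- F1, <- F2, <- F3; ring.
  replace (s ^ 2) with (1 - c ^ 2) by lra; ring.
assert (G12 : g12 = 4 * ((a t ^ 2 - 1) * (c * s))).
  transitivity (g12 * (s * s + c * c) ^ 2); [rewrite Hcs; ring|].
  transitivity (c * s * (4 * a t ^ 2) + (c ^ 2 - s ^ 2) * 0 - c * s * 4); [|ring].
  rewrite <- F1, <- F2, <- F3; ring.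
assert (G22 : g22 = 4 * (1 + (a t ^ 2 - 1) * s ^ 2)).
  transitivity (g22 * (s * s + c * c) ^ 2); [rewrite Hcs; ring|].
  transitivity (s ^ 2 * (4 * a t ^ 2) + 2 * (c * s) * 0 + c ^ 2 * 4).
    rewrite <- F1, <- F2, <- F3; ring.
  replace (c ^ 2) with (1 - s ^ 2) by lra; ring.
assert (C1 : coord i1 (polar p) = sqrt t * c) by reflexivity.
assert (C2 : coord i2 (polar p) = sqrt t * s) by reflexivity.
assert (K : forall x y, (a t ^ 2 - 1) / t * (sqrt t * x) * (sqrt t * y)
  = (a t ^ 2 - 1) * (x * y)).
  intros x y; transitivity ((a t ^ 2 - 1) / t * (sqrt t * sqrt t) * (x * y)); [ring|].
  rewrite E; field; lra.
intros i j; destruct i, j; simpl kronecker; rewrite ?C1, ?C2, K;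
  fold g11 g12 g22; rewrite <- ?Hs, ?G11, ?G12, ?G22; ring.
Qed.

Lemma radial_to_polar a g : (forall q, punctured_plane q -> forall i j,
    g i j q = radial_metric (fun t => (a t ^ 2 - 1) / t) i j q) ->
  is_G_in_polar a g.
Proof.
intros Eg p Hp i j; rewrite pullback_polar by assumption; cbv zeta.
assert (Hq := polar_punctured p Hp); rewrite !Eg by assumption.
assert (Hcs := sin2_cos2 (snd p)); unfold Rsqr in Hcs.
unfold radial_metric; rewrite rsq_polar by assumption.
assert (C1 : coord i1 (polar p) = sqrt (fst p) * cos (snd p)) by reflexivity.
assert (C2 : coord i2 (polar p) = sqrt (fst p) * sin (snd p)) by reflexivity.
rewrite !C1, !C2; unfold half_plane in Hp.
assert (E := sqrt_sqrt (fst p) ltac:(lra)).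
set (t := fst p) in *; set (c := cos (snd p)) in *; set (s := sin (snd p)) in *.
assert (K : forall x y, (a t ^ 2 - 1) / t * (sqrt t * x) * (sqrt t * y)
  = (a t ^ 2 - 1) * (x * y)).
  intros x y; transitivity ((a t ^ 2 - 1) / t * (sqrt t * sqrt t) * (x * y)); [ring|].
  rewrite E; field; lra.
rewrite !K; assert (Ec : c ^ 2 = 1 - s ^ 2) by lra.
destruct i, j; simpl kronecker; simpl G; fold t.
- transitivity ((s * s + c * c + (a t ^ 2 - 1) * (s * s + c * c) ^ 2) / t);
    [field; lra|rewrite Hcs; field; lra].
- field.
- field.
- transitivity (4 * t * (s * s + c * c)); [ring|rewrite Hcs; ring].
Qed.

(** * The plane *)

(** Constant curvature would make [a] constant and hence a zero of the right-hand side 2 a^2 (lam a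
    - 2 mu), which is negative for a > gamma. *)
Lemma soliton_ode_curvature_nonconstant lam mu a K : lam < 0 -> mu < 0 ->
  soliton_ode lam mu a -> (forall t, 0 < t -> 2 * mu / lam < a t) ->
  ~ forall t, 0 < t -> lam - 2 * mu / a t = K.
Proof.
intros Hl Hm Ha Hg H; destruct (Ha 1 Rlt_0_1) as [Hp Da].
assert (E : forall t, 0 < t -> a t = a 1).
  intros t Ht; destruct (Ha t Ht) as [Ht' _].
  assert (E := H t Ht); rewrite <- (H 1 Rlt_0_1) in E.
  apply Rinv_eq_reg, Rmult_eq_reg_l with (2 * mu); [unfold Rdiv in E|]; lra.
assert (D0 : is_derive a 1 0).
  apply is_derive_ext_loc with (fun _ => a 1); [|auto_derive; trivial].
  generalize (open_gt 0 1 Rlt_0_1); apply filter_imp; intros t Ht; symmetry; apply E, Ht.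
assert (Z : 2 * lam * a 1 ^ 3 - 4 * mu * a 1 ^ 2 = 0).
  transitivity (Derive a 1); [symmetry|]; now apply is_derive_unique.
assert (Q : lam * a 1 < 2 * mu).
  replace (2 * mu) with (lam * (2 * mu / lam)) by (field; lra).
  apply Rmult_lt_gt_compat_neg_l; [assumption|apply Hg; lra].
assert (0 < a 1 ^ 2) by nra.
assert (a 1 ^ 2 * (lam * a 1 - 2 * mu) = 0) by nra.
nra.
Qed.

(** The device for crossing the origin: applied to a difference and its negative it extends
    identities, and applied to a quadratic form it extends lower bounds on the metric. *)
Lemma origin_nonneg (f : pt -> R) : continuous f (0, 0) ->
  (forall p, punctured_plane p -> 0 <= f p) -> 0 <= f (0, 0).
Proof.
intros Hc Hf; apply Rnot_lt_le; intros Hn.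
assert (He : 0 < - f (0, 0)) by lra.
destruct (Hc _ (locally_ball (f (0, 0)) (mkposreal _ He))) as [d Hd].
assert (Hd2 := cond_pos d).
assert (B : ball (0, 0) d (pos d / 2, 0)).
  split; simpl; [|apply ball_center].
  unfold ball; simpl; unfold AbsRing_ball, abs, minus, plus, opp; simpl.
  rewrite Rabs_right; lra.
specialize (Hd _ B); unfold ball in Hd; simpl in Hd.
unfold AbsRing_ball, abs, minus, plus, opp in Hd; simpl in Hd.
assert (P : punctured_plane (pos d / 2, 0)).
  intros E; injection E; lra.
specialize (Hf _ P); apply Rabs_def2 in Hd; lra.
Qed.

Lemma open_plane : open plane.
Proof. apply open_true. Qed.

Lemma smooth_eq_off_origin f h : smooth_on plane f -> smooth_on plane h ->
  (forall p, punctured_plane p -> f p = h p) -> forall p, f p = h p.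
Proof.
intros Sf Sh E p.
destruct (Rtotal_order 0 (rsq p)) as [H|H]; [now apply E, punctured_plane_rsq|].
assert (Ep : p = (0, 0)).
  destruct p as [x y]; unfold rsq in H; simpl in H; f_equal; nra.
rewrite Ep; apply Rminus_diag_uniq, Rle_antisym.
- apply Ropp_le_cancel; rewrite Ropp_0; apply (origin_nonneg (fun q => - (f q - h q))).
  + apply (smooth_on_continuous plane); [|exact I].
    apply (smooth_opp _ open_plane), (smooth_minus _ open_plane); assumption.
  + intros q Hq; rewrite E by assumption; lra.
- apply (origin_nonneg (fun q => f q - h q)).
  + apply (smooth_on_continuous plane); [|exact I].
    apply (smooth_minus _ open_plane); assumption.
  + intros q Hq; rewrite E by assumption; lra.
Qed.

Lemma smooth_on_sub (U V : pt -> Prop) f : (forall p, U p -> V p) ->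
  smooth_on V f -> smooth_on U f.
Proof. intros H Hf n p Up; apply Hf, H, Up. Qed.

Lemma riemannian_sub (U V : pt -> Prop) g : open U -> (forall p, U p -> V p) ->
  riemannian V g -> riemannian U g.
Proof.
intros HU H [_ [H1 [H2 H3]]]; split; [assumption|split; [|split]]; auto.
intros i j; now apply smooth_on_sub with V.
Qed.

Section Plane.
Variables (lam mu : R) (a : R -> R) (g : metric).
Hypotheses (Hl : lam < 0) (Hm : mu < 0) (Ha : soliton_ode lam mu a)
  (a_gt : forall t, 0 < t -> 2 * mu / lam < a t) (gamma_lt1 : 2 * mu / lam < 1)
  (a_lim : filterlim a (at_right 0) (locally 1))
  (Hg : riemannian plane g)
  (Eg : forall p, punctured_plane p -> forall i j,
    g i j p = radial_metric (fun t => (a t ^ 2 - 1) / t) i j p).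

Let s p := sqrt (detg g p) / 4.

Lemma plane_sqrt_detg p : punctured_plane p -> s p = a (rsq p).
Proof.
intros Hp; unfold s; rewrite (radial_detg lam mu a g Ha Eg p Hp).
destruct (Ha _ (rsq_pos p Hp)) as [H _].
replace (16 * a (rsq p) ^ 2) with ((4 * a (rsq p))²) by (unfold Rsqr; ring).
rewrite sqrt_Rsqr; lra.
Qed.

Lemma plane_sqrt_detg_pos p : 0 < s p.
Proof.
unfold s; apply Rdiv_lt_0_compat; [|lra].
now apply sqrt_lt_R0, (riemannian_detg_pos plane).
Qed.

Lemma plane_smooth_sqrt_detg : smooth_on plane s.
Proof.
assert (HU := open_plane).
apply smooth_mult; trivial; [|now apply smooth_const].
apply (smooth_comp _ HU (fun t => 0 < t) sqrt (detg g)).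
- apply smooth1_sqrt.
- intros p Hp; now apply (riemannian_detg_pos plane).
- now apply smooth_detg.
Qed.

(** A strict inequality weakens in the limit, so a > gamma alone does not make the curvature
    negative at the origin. The exact value of [s] there, combined with gamma < 1, does. *)
Lemma plane_sqrt_detg_origin : s (0, 0) = 1.
Proof.
apply (filterlim_locally_unique (F := at_right 0) (fun x => s (x, 0))).
- apply filterlim_comp with (2 :=
    smooth_on_continuous plane s (0, 0) plane_smooth_sqrt_detg I).
  intros P [d Hd]; exists d; intros x Hx _; apply Hd; split; [exact Hx|apply ball_center].
- apply filterlim_ext_loc with (fun x => a (x ^ 2)).
    exists (mkposreal 1 Rlt_0_1); intros x _ Hx; rewrite plane_sqrt_detg.
      unfold rsq; simpl; f_equal; ring.
    intros E; injection E; lra.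
  apply filterlim_comp with (2 := a_lim).
  intros P [d Hd]; assert (Hd0 := cond_pos d).
  assert (H1 : 0 < Rmin 1 d) by (apply Rmin_pos; lra).
  exists (mkposreal _ H1); intros x Hx Hx0.
  unfold ball in Hx; simpl in Hx; unfold AbsRing_ball, abs, minus, plus, opp in Hx.
  simpl in Hx; rewrite Ropp_0, Rplus_0_r, Rabs_right in Hx by lra.
  assert (Q := Rmin_l 1 d); assert (Q' := Rmin_r 1 d).
  apply Hd; [|simpl; nra].
  unfold ball; simpl; unfold AbsRing_ball, abs, minus, plus, opp; simpl.
  rewrite Ropp_0, Rplus_0_r, Rabs_right; nra.
Qed.

Lemma plane_curvature p : curvature g p = lam - 2 * mu / s p.
Proof.
revert p; assert (HU := open_plane); apply smooth_eq_off_origin.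
- now apply smooth_curvature.
- apply smooth_minus; trivial; [now apply smooth_const|].
  apply smooth_div; trivial; [now apply smooth_const|apply plane_smooth_sqrt_detg|].
  intros p _; apply Rgt_not_eq, plane_sqrt_detg_pos.
- intros p Hp; apply curvature_from_ricci.
  + now apply Rgt_not_eq, (riemannian_detg_pos plane).
  + now apply Hg.
  + intros i j; rewrite plane_sqrt_detg by assumption.
    now apply radial_ricci.
Qed.

Lemma plane_curvature_neg p : curvature g p < 0.
Proof.
rewrite plane_curvature.
assert (Hs : 2 * mu / lam < s p).
  destruct (Rtotal_order 0 (rsq p)) as [H|H].
    rewrite plane_sqrt_detg by now apply punctured_plane_rsq.
    now apply a_gt.
  replace p with (0, 0).
    now rewrite plane_sqrt_detg_origin.
  destruct p as [x y]; unfold rsq in H; simpl in H; f_equal; nra.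
assert (Hp := plane_sqrt_detg_pos p).
assert (Q : lam * s p < 2 * mu).
  replace (2 * mu) with (lam * (2 * mu / lam)) by (field; lra).
  now apply Rmult_lt_gt_compat_neg_l.
apply Rmult_lt_reg_r with (s p); [assumption|].
replace ((lam - 2 * mu / s p) * s p) with (lam * s p - 2 * mu) by (field; lra).
lra.
Qed.

Lemma plane_soliton : exists X, ricci_soliton plane g X lam.
Proof.
assert (HU := open_plane).
set (X := fun l p => 2 * mu / s p * coord l p).
assert (SX : forall l, smooth_on plane (X l)).
  intros l; apply smooth_mult; trivial; [|now apply smooth_coord].
  apply smooth_div; trivial; [now apply smooth_const|apply plane_smooth_sqrt_detg|].
  intros p _; apply Rgt_not_eq, plane_sqrt_detg_pos.
exists X; split; [assumption|split; [assumption|]].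
intros p _ i j; revert p; apply smooth_eq_off_origin.
- apply smooth_mult; trivial; [now apply smooth_const|now apply smooth_ricci].
- apply smooth_minus; trivial; [now apply smooth_lie_metric|].
  apply smooth_mult; trivial; [now apply smooth_const|apply Hg].
- intros p Hp; apply (radial_soliton_equation lam mu a); trivial.
  intros l q Hq; unfold X; now rewrite plane_sqrt_detg.
Qed.

Lemma plane_not_hyperbolic :
  ~ isometric_up_to_scaling plane g upper_half_plane hyperbolic_metric.
Proof.
intros H; destruct (isometric_hyperbolic_curvature plane g Hg H) as [K HK].
apply (soliton_ode_curvature_nonconstant lam mu a K); trivial.
intros t Ht; rewrite <- (HK (sqrt t, 0) I), plane_curvature.
assert (Hs := sqrt_lt_R0 t Ht).
rewrite plane_sqrt_detg by (intros E; injection E; lra).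
unfold rsq; simpl fst; simpl snd; rewrite pow2_sqrt by lra.
now replace (t + 0 ^ 2) with t by ring.
Qed.

End Plane.

(** * Completeness *)

(** Infinitesimal form of being C-Lipschitz for the Riemannian distance: the gradient has length at
    most [C], expressed through curves only. *)
Definition lipschitz_along_curves (U : pt -> Prop) g (f : pt -> R) C : Prop :=
  forall c t, U (c t) -> (forall i, ex_derive (fun s => coord i (c s)) t) ->
    exists d, is_derive (fun s => f (c s)) t d /\ Rabs d <= C * speed g c t.

Lemma continuous_pt {T : UniformSpace} (c : T -> pt) t :
  (forall i, continuous (fun s => coord i (c s)) t) -> continuous c t.
Proof.
intros H P [d Hd].
assert (H1 := H i1 _ (locally_ball _ d)); assert (H2 := H i2 _ (locally_ball _ d)).
unfold filtermap in *; generalize (filter_and _ _ H1 H2); apply filter_imp.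
intros s [B1 B2]; apply Hd; split; assumption.
Qed.

Lemma C1_curve_continuous c t : C1_curve c -> continuous c t.
Proof.
intros Hc; apply continuous_pt; intros i.
apply (ex_derive_continuous (fun s => coord i (c s))), Hc.
Qed.

Lemma speed_continuous U g c t : riemannian U g -> C1_curve c -> U (c t) ->
  continuous (speed g c) t.
Proof.
intros Hg Hc Ut; apply (continuous_comp _ sqrt); [|apply continuous_sqrt].
assert (K : forall i j, continuous (fun t => g i j (c t)
  * Derive (fun s => coord i (c s)) t * Derive (fun s => coord j (c s)) t) t).
  intros i j; apply (continuous_mult (fun t => _ * _)); [|apply Hc].
  apply (continuous_mult (fun t => g i j (c t))); [|apply Hc].
  apply (continuous_comp c (g i j)); [now apply C1_curve_continuous|].
  now apply (smooth_on_continuous U); [apply Hg|].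
assert (Kp : forall f h : R -> R, continuous f t -> continuous h t ->
    continuous (fun t => f t + h t) t) by (intros f h; apply (continuous_plus f h)).
unfold sum2; apply Kp; apply Kp; apply K.
Qed.

(** Curves are defined on all of R and [U] is open, so the curve stays in [U] a little beyond its
    end points; the derivative is two-sided there as well. *)
Lemma speed_RInt_derive U g c a b t : riemannian U g -> C1_curve c ->
  (forall s, a <= s <= b -> U (c s)) -> a <= t <= b ->
  is_derive (RInt (speed g c) a) t (speed g c t).
Proof.
intros Hg Hc HU Ht; apply (is_derive_RInt (speed g c) _ a t).
2: apply speed_continuous with U; auto.
assert (N : locally t (fun s => U (c s))).
  apply (C1_curve_continuous c t Hc), (proj1 Hg), HU, Ht.
destruct N as [d Hd]; exists d; intros y Hy; apply (@RInt_correct R_CompleteNormedModule).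
apply ex_RInt_Chasles with t; apply (@ex_RInt_continuous R_CompleteNormedModule);
  intros z Hz; apply speed_continuous with U; trivial.
  rewrite Rmin_left, Rmax_right in Hz by lra; apply HU; lra.
apply Hd.
unfold ball in *; simpl in *; unfold AbsRing_ball, abs, minus, plus, opp in *; simpl in *.
revert Hz Hy; unfold Rmin, Rmax; destruct (Rle_dec t y); intros Hz Hy;
  apply Rabs_def2 in Hy; apply Rabs_def1; lra.
Qed.

(** For e = 1 and e = -1, the function C times arc length minus e f(c) has nonnegative derivative.
    The mean value theorem is used because the derivative of f(c) need not be integrable. *)
Lemma lipschitz_curve_length U g f C p q L : riemannian U g ->
  lipschitz_along_curves U g f C -> curve_length U g p q L -> Rabs (f q - f p) <= C * L.
Proof.
intros Hg Hf H; induction H as [c a b Hab Hc HU|p q r L1 L2 _ IH1 _ IH2].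
2: { replace (f r - f p) with ((f q - f p) + (f r - f q)) by ring.
  eapply Rle_trans; [apply Rabs_triang|lra]. }
assert (K : forall e, Rabs e = 1 -> e * (f (c b) - f (c a)) <= C * RInt (speed g c) a b).
  intros e He.
  assert (D : forall t, a <= t <= b -> exists d, 0 <= d /\
    is_derive (fun s => C * RInt (speed g c) a s - e * f (c s)) t d).
    intros t Ht; destruct (Hf c t (HU t Ht) (fun i => proj1 (Hc i t))) as [d [Hd Bd]].
    exists (C * speed g c t - e * d); split.
      assert (Rabs (e * d) <= C * speed g c t) by (rewrite Rabs_mult, He; lra).
      pose proof (Rle_abs (e * d)); lra.
    apply (is_derive_minus (fun s => C * RInt (speed g c) a s) (fun s => e * f (c s)));
      apply (is_derive_scal _ t); [|exact Hd].
    now apply speed_RInt_derive with U b.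
  destruct (MVT_gen (fun s => C * RInt (speed g c) a s - e * f (c s)) a b
    (Derive (fun s => C * RInt (speed g c) a s - e * f (c s)))) as [x [Hx E]].
  - rewrite Rmin_left, Rmax_right by lra; intros x Hx.
    destruct (D x ltac:(lra)) as [d [_ Hd]]; apply Derive_correct; now exists d.
  - rewrite Rmin_left, Rmax_right by lra; intros x Hx.
    destruct (D x ltac:(lra)) as [d [_ Hd]]; apply continuity_pt_filterlim.
    apply (ex_derive_continuous (fun s => C * RInt (speed g c) a s - e * f (c s))).
    now exists d.
  - rewrite Rmin_left, Rmax_right in Hx by lra; destruct (D x Hx) as [d [Pd Hd]].
    replace (Derive _ x) with d in E by (symmetry; now apply is_derive_unique).
    rewrite RInt_point in E; unfold zero in E; simpl in E; nra.
assert (K1 := K 1 Rabs_R1); assert (K2 := K (-1) ltac:(rewrite Rabs_left; lra)).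
apply Rabs_le; lra.
Qed.

Lemma riem_dist_lt_curve U g p q eps : Rbar_lt (riem_dist U g p q) (Finite eps) ->
  exists L, curve_length U g p q L /\ L < eps.
Proof.
intros H; apply Classical_Prop.NNPP; intros N; revert H; apply Rbar_le_not_lt.
apply (Glb_Rbar_correct (curve_length U g p q)); intros L HL; simpl.
apply Rnot_lt_le; intros HL'; apply N; now exists L.
Qed.

Lemma curve_riem_dist_lt U g p q L eps : curve_length U g p q L -> L < eps ->
  Rbar_lt (riem_dist U g p q) (Finite eps).
Proof.
intros H HL; apply Rbar_le_lt_trans with (Finite L); [|exact HL].
now apply (Glb_Rbar_correct (curve_length U g p q)).
Qed.

(** Turns convergence in the chart into convergence in distance: near [p] all entries of the metric
    are bounded by [M], and straight segments are estimated with this bound. *)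
Lemma short_segment U g p : riemannian U g -> U p -> exists M delta, 0 < delta /\
  forall q, Rabs (fst q - fst p) < delta -> Rabs (snd q - snd p) < delta ->
    exists L, curve_length U g q p L /\
      L <= M * (Rabs (fst q - fst p) + Rabs (snd q - snd p)).
Proof.
intros Hg Up.
assert (B : forall i j, locally p (fun q => Rabs (g i j q) < Rabs (g i j p) + 1)).
  intros i j.
  assert (Hc := smooth_on_continuous U (g i j) p (proj1 (proj2 Hg) i j) Up).
  assert (Hb := Hc _ (locally_ball _ (mkposreal 1 Rlt_0_1))); unfold filtermap in Hb.
  revert Hb; apply filter_imp.
  intros q Hq; unfold ball in Hq; simpl in Hq.
  unfold AbsRing_ball, abs, minus, plus, opp in Hq; simpl in Hq.
  assert (T := Rabs_triang (g i j q + - g i j p) (g i j p)).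
  replace (g i j q + - g i j p + g i j p) with (g i j q) in T by ring; lra.
set (M := Rabs (g i1 i1 p) + Rabs (g i1 i2 p) + Rabs (g i2 i1 p) + Rabs (g i2 i2 p) + 1).
assert (HM : forall i j, Rabs (g i j p) + 1 <= M).
  pose proof (Rabs_pos (g i1 i1 p)); pose proof (Rabs_pos (g i1 i2 p)).
  pose proof (Rabs_pos (g i2 i1 p)); pose proof (Rabs_pos (g i2 i2 p)).
  unfold M; intros [|] [|]; lra.
assert (HM1 : 1 <= M) by (pose proof (HM i1 i1); pose proof (Rabs_pos (g i1 i1 p)); lra).
destruct (filter_and _ _ (proj1 Hg p Up) (filter_and _ _
  (filter_and _ _ (B i1 i1) (B i1 i2)) (filter_and _ _ (B i2 i1) (B i2 i2)))) as [d Hd].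
exists M, d; split; [apply cond_pos|]; intros q H1 H2.
set (v := fun i => coord i p - coord i q).
set (c := fun s : R => (fst q + s * v i1, snd q + s * v i2)).
assert (D : forall i s, is_derive (fun s => coord i (c s)) s (v i)).
  intros [|] s; unfold c; simpl; auto_derive; trivial; ring.
assert (Hc : C1_curve c).
  intros i t; split; [eexists; apply D|].
  apply continuous_ext with (fun _ => v i); [|apply continuous_const].
  intros s; symmetry; apply is_derive_unique, D.
assert (C0 : c 0 = q) by (destruct q; unfold c; simpl; f_equal; ring).
assert (C1 : c 1 = p) by (destruct p, q; unfold c, v; simpl; f_equal; ring).
assert (Bs : forall s, 0 <= s <= 1 -> ball p d (c s)).
  assert (Q : forall x y s, Rabs (x - y) < d -> 0 <= s <= 1 ->
    Rabs (x + s * (y - x) + - y) < d).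
    intros x y s H Hs; replace (x + s * (y - x) + - y) with ((1 - s) * (x - y)) by ring.
    rewrite Rabs_mult, (Rabs_right (1 - s)) by lra; pose proof (Rabs_pos (x - y)); nra.
  intros s Hs; split; unfold ball; simpl; unfold AbsRing_ball, abs, minus, plus, opp; simpl;
    now apply Q.
exists (RInt (speed g c) 0 1); split.
  rewrite <- C0 at 1; rewrite <- C1; apply length_piece; [lra|assumption|].
  intros t Ht; apply Hd, Bs, Ht.
set (b := Rabs (v i1) + Rabs (v i2)).
assert (Eb : Rabs (fst q - fst p) + Rabs (snd q - snd p) = b).
  unfold b, v; simpl; now rewrite (Rabs_minus_sym (fst p)), (Rabs_minus_sym (snd p)).
rewrite Eb; replace (M * b) with (RInt (fun _ => M * b) 0 1)
  by (rewrite RInt_const; unfold scal; simpl; unfold mult; simpl; ring).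
apply RInt_le; [lra| |apply ex_RInt_const|].
  apply (@ex_RInt_continuous R_CompleteNormedModule); intros z Hz.
  rewrite Rmin_left, Rmax_right in Hz by lra.
  apply speed_continuous with U; trivial; apply Hd, Bs, Hz.
intros s Hs; assert (P1 := Rabs_pos (v i1)); assert (P2 := Rabs_pos (v i2)).
assert (b0 : 0 <= b) by (unfold b; lra).
unfold speed; rewrite <- (sqrt_Rsqr (M * b)) by nra; apply sqrt_le_1_alt.
destruct (Hd (c s) (Bs s ltac:(lra))) as [_ [[B11 B12] [B21 B22]]].
assert (T : forall i j, Rabs (g i j (c s)) < Rabs (g i j p) + 1 ->
  g i j (c s) * Derive (fun s => coord i (c s)) s * Derive (fun s => coord j (c s)) s
  <= M * (Rabs (v i) * Rabs (v j))).
  intros i j Bij; rewrite !(is_derive_unique _ _ _ (D _ s)).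
  eapply Rle_trans; [apply Rle_abs|]; rewrite !Rabs_mult, Rmult_assoc.
  apply Rmult_le_compat_r; [apply Rmult_le_pos; apply Rabs_pos|].
  specialize (HM i j); lra.
assert (T1 := T _ _ B11); assert (T2 := T _ _ B12).
assert (T3 := T _ _ B21); assert (T4 := T _ _ B22).
(* The quadratic form is at most M (|v1| + |v2|)^2, and M <= M^2 since M >= 1. *)
apply Rle_trans with (M * b²).
  unfold sum2, b, Rsqr in *; lra.
unfold Rsqr; assert (0 <= b * b) by nra; nra.
Qed.

(** Lipschitz functions take a Cauchy sequence to Cauchy sequences of reals, so [f1] and [f2]
    converge along it. The last hypothesis turns these limits into a limit point in [U], and short
    segments give convergence in distance. *)
Lemma complete_from_coordinates U g f1 f2 C : riemannian U g -> 0 < C ->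
  lipschitz_along_curves U g f1 C -> lipschitz_along_curves U g f2 C ->
  (forall (u : nat -> pt) (l1 l2 : R), (forall n, U (u n)) ->
     is_lim_seq (fun n => f1 (u n)) l1 -> is_lim_seq (fun n => f2 (u n)) l2 ->
     exists p, U p /\ is_lim_seq (fun n => fst (u n)) (fst p)
                   /\ is_lim_seq (fun n => snd (u n)) (snd p)) ->
  complete_metric U g.
Proof.
intros Hg HC H1 H2 Hlim u Uu Cu.
assert (K : forall f, lipschitz_along_curves U g f C ->
  exists l : R, is_lim_seq (fun n => f (u n)) l).
  intros f Hf; apply ex_lim_seq_cauchy_corr; intros eps.
  assert (He : 0 < eps / C) by (apply Rdiv_lt_0_compat; [apply cond_pos|assumption]).
  destruct (Cu _ He) as [N HN]; exists N; intros n m Hn Hm.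
  destruct (riem_dist_lt_curve U g _ _ _ (HN m n Hm Hn)) as [L [HL L1]].
  eapply Rle_lt_trans; [apply (lipschitz_curve_length U g f C _ _ L); trivial|].
  replace (pos eps) with (C * (eps / C)) by (field; lra).
  now apply Rmult_lt_compat_l.
destruct (K f1 H1) as [l1 L1], (K f2 H2) as [l2 L2].
destruct (Hlim u l1 l2 Uu L1 L2) as [p [Up [P1 P2]]].
exists p; split; [assumption|]; intros eps He.
destruct (short_segment U g p Hg Up) as [M [d [Hd HM]]].
set (e := Rmin d (eps / (2 * (Rabs M + 1)))).
assert (HM0 := Rabs_pos M).
assert (Pe : 0 < e).
  apply Rmin_pos; [assumption|apply Rdiv_lt_0_compat; lra].
apply is_lim_seq_spec in P1, P2.
destruct (P1 (mkposreal e Pe)) as [N1 E1], (P2 (mkposreal e Pe)) as [N2 E2].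
exists (max N1 N2); intros n Hn.
specialize (E1 n ltac:(lia)); specialize (E2 n ltac:(lia)); simpl in E1, E2.
assert (Q1 := Rmin_l d (eps / (2 * (Rabs M + 1)))); fold e in Q1.
assert (Q2 := Rmin_r d (eps / (2 * (Rabs M + 1)))); fold e in Q2.
destruct (HM (u n)) as [L [HL BL]]; [lra|lra|].
apply (curve_riem_dist_lt U g _ _ L); trivial.
apply Rle_lt_trans with (1 := BL).
set (x := Rabs (fst (u n) - fst p)) in *; set (y := Rabs (snd (u n) - snd p)) in *.
assert (X0 : 0 <= x) by apply Rabs_pos; assert (Y0 : 0 <= y) by apply Rabs_pos.
apply Rle_lt_trans with (Rabs M * (x + y)).
  apply Rmult_le_compat_r; [lra|apply Rle_abs].
apply Rle_lt_trans with ((Rabs M + 1) * (x + y)); [nra|].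
apply Rlt_le_trans with ((Rabs M + 1) * (2 * e)); [apply Rmult_lt_compat_l; lra|].
replace eps with ((Rabs M + 1) * (2 * (eps / (2 * (Rabs M + 1))))) by (field; lra).
apply Rmult_le_compat_l; lra.
Qed.

(** * Lipschitz coordinates for the two metrics *)

Lemma Rabs_le_speed g c t C d : 0 <= C ->
  d ^ 2 <= C ^ 2 * sum2 (fun i => sum2 (fun j =>
    g i j (c t) * Derive (fun s => coord i (c s)) t
                * Derive (fun s => coord j (c s)) t)) ->
  Rabs d <= C * speed g c t.
Proof.
intros HC H; unfold speed.
rewrite <- (sqrt_Rsqr C HC) at 1.
rewrite <- sqrt_mult_alt by apply Rle_0_sqr; rewrite <- sqrt_Rsqr_abs.
apply sqrt_le_1_alt; unfold Rsqr; simpl in H; lra.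
Qed.

Lemma is_derive_ln_comp f t : ex_derive f t -> 0 < f t ->
  is_derive (fun s => ln (f s)) t (Derive f t / f t).
Proof.
intros Df Hf; auto_derive; [now split|].
change (Derive (fun s => f s) t) with (Derive f t); field; lra.
Qed.

Lemma is_derive_arcsinh_comp f h t : ex_derive f t -> ex_derive h t -> 0 < f t ->
  is_derive (fun s => arcsinh (h s * sqrt (f s))) t
    (/ sqrt ((h t * sqrt (f t)) ^ 2 + 1) *
     (Derive h t * sqrt (f t) + h t * (Derive f t / (2 * sqrt (f t))))).
Proof.
intros Df Dh Hf; rewrite Rmult_comm.
apply (is_derive_comp arcsinh (fun s => h s * sqrt (f s))).
  apply is_derive_Reals, derivable_pt_lim_arcsinh.
assert (Hs := sqrt_lt_R0 _ Hf).
auto_derive; [now repeat split|].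
change (Derive (fun s => f s) t) with (Derive f t).
change (Derive (fun s => h s) t) with (Derive h t); field; lra.
Qed.

(** The bound 4 t a^2 >= 1 makes ln t Lipschitz. The angle is not, since 4 t dtheta^2 degenerates at
    t = 0. For w = theta sqrt t one has dw = sqrt t dtheta + (w / 2) dt / t, where only the factor w
    is unbounded; passing to arcsinh divides by sqrt (1 + w^2) and tames it. *)
Lemma half_plane_complete lam mu a g : soliton_ode lam mu a ->
  (forall p, half_plane p -> forall i j, g i j p = G a i j p) ->
  (forall t, 0 < t -> 1 <= 4 * t * a t ^ 2) -> complete_metric half_plane g.
Proof.
intros Ha Eg Hb.
assert (Hspeed : forall c t, half_plane (c t) -> sum2 (fun i => sum2 (fun j =>
    g i j (c t) * Derive (fun s => coord i (c s)) t
                * Derive (fun s => coord j (c s)) t))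
  = a (fst (c t)) ^ 2 / fst (c t) * Derive (fun s => fst (c s)) t ^ 2
    + 4 * fst (c t) * Derive (fun s => snd (c s)) t ^ 2).
  intros c t Ht; unfold sum2; rewrite !Eg by assumption; simpl; ring.
assert (HA : forall x X, 0 < x -> (X / x) ^ 2 <= 4 * (a x ^ 2 / x * X ^ 2)).
  intros x X Hx; specialize (Hb x Hx).
  replace ((X / x) ^ 2) with (1 * (X ^ 2 / x ^ 2)) by (field; lra).
  replace (4 * (a x ^ 2 / x * X ^ 2)) with (4 * x * a x ^ 2 * (X ^ 2 / x ^ 2))
    by (field; lra).
  apply Rmult_le_compat_r; [|assumption].
  apply Rmult_le_pos; [nra|apply Rlt_le, Rinv_0_lt_compat; nra].
apply complete_from_coordinates with (fun p => ln (fst p))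
  (fun p => arcsinh (snd p * sqrt (fst p))) 2; [|lra| | |].
- now apply G_riemannian with lam mu a.
- intros c t Ht D; exists (Derive (fun s => fst (c s)) t / fst (c t)).
  assert (D1 := D i1); simpl in D1; unfold half_plane in Ht.
  split; [now apply (is_derive_ln_comp (fun s => fst (c s)))|].
  apply Rabs_le_speed; [lra|]; rewrite Hspeed by assumption.
  specialize (HA (fst (c t)) (Derive (fun s => fst (c s)) t) Ht).
  set (X := Derive (fun s => fst (c s)) t) in *.
  set (Y := Derive (fun s => snd (c s)) t) in *.
  assert (0 <= fst (c t) * Y ^ 2) by (apply Rmult_le_pos; [lra|nra]).
  nra.
- intros c t Ht D; assert (D1 := D i1); assert (D2 := D i2); simpl in D1, D2.
  unfold half_plane in Ht.
  specialize (HA (fst (c t)) (Derive (fun s => fst (c s)) t) Ht).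
  assert (Hs := sqrt_lt_R0 _ Ht); assert (Es := sqrt_sqrt (fst (c t)) ltac:(lra)).
  set (x := fst (c t)) in *; set (y := snd (c t)).
  set (X := Derive (fun s => fst (c s)) t) in *.
  set (Y := Derive (fun s => snd (c s)) t).
  set (w := y * sqrt x).
  assert (Hw : 0 < sqrt (w ^ 2 + 1)) by (apply sqrt_lt_R0; nra).
  exists (/ sqrt (w ^ 2 + 1) * (Y * sqrt x + y * (X / (2 * sqrt x)))); split.
    now apply (is_derive_arcsinh_comp (fun s => fst (c s)) (fun s => snd (c s))).
  apply Rabs_le_speed; [lra|]; rewrite Hspeed by assumption; fold x X Y.
  assert (E2 := sqrt_sqrt (w ^ 2 + 1) ltac:(nra)).
  set (r := sqrt (w ^ 2 + 1)) in *.
  assert (Ed : / r * (Y * sqrt x + y * (X / (2 * sqrt x)))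
    = / r * (Y * sqrt x) + w / r * (X / x) / 2).
    replace (X / x) with (X / (sqrt x * sqrt x)) by now rewrite Es.
    unfold w; field; lra.
  assert (Hr : (/ r) ^ 2 <= 1).
    rewrite pow_inv, <- Rinv_1; apply Rinv_le_contravar; [lra|].
    replace (r ^ 2) with (r * r) by ring; rewrite E2; nra.
  assert (Hwr : (w / r) ^ 2 <= 1).
    apply Rmult_le_reg_r with (r ^ 2); [nra|].
    replace ((w / r) ^ 2 * r ^ 2) with (w ^ 2) by (field; lra).
    replace (r ^ 2) with (r * r) by ring; rewrite E2; lra.
  rewrite Ed.
  (* The square of a sum is at most twice the sum of the squares. *)
  apply Rle_trans with (2 * (/ r) ^ 2 * (Y * sqrt x) ^ 2
    + (w / r) ^ 2 * (X / x) ^ 2 / 2).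
    pose proof (Rle_0_sqr (/ r * (Y * sqrt x) - w / r * (X / x) / 2)) as Q.
    unfold Rsqr in Q; nra.
  apply Rle_trans with (2 * (Y * sqrt x) ^ 2 + (X / x) ^ 2 / 2).
    assert (0 <= (Y * sqrt x) ^ 2) by nra; assert (0 <= (X / x) ^ 2) by nra; nra.
  replace ((Y * sqrt x) ^ 2) with (Y ^ 2 * x) by (rewrite <- Es at 1; ring).
  assert (0 <= Y ^ 2 * x) by (apply Rmult_le_pos; [nra|lra]).
  assert (0 <= (X / x) ^ 2) by nra; lra.
(* The limits are transported back by exp and sinh; the first coordinate of the limit is [exp l1],
   so it stays inside the open half-plane. *)
- intros u l1 l2 Uu L1 L2.
  assert (L3 : is_lim_seq (fun n => fst (u n)) (exp l1)).
    apply is_lim_seq_ext with (fun n => exp (ln (fst (u n)))).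
      intros n; apply exp_ln, Uu.
    apply (is_lim_seq_continuous exp _ l1); [|assumption].
    apply derivable_continuous_pt, derivable_pt_exp.
  assert (L4 : is_lim_seq (fun n => snd (u n) * sqrt (fst (u n))) (sinh l2)).
    apply is_lim_seq_ext with (fun n => sinh (arcsinh (snd (u n) * sqrt (fst (u n))))).
      intros n; apply sinh_arcsinh.
    apply (is_lim_seq_continuous sinh _ l2); [|assumption].
    apply derivable_continuous_pt, derivable_pt_sinh.
  assert (Hp := exp_pos l1); assert (Hs := sqrt_lt_R0 _ Hp).
  exists (exp l1, sinh l2 / sqrt (exp l1)); split; [exact Hp|split; [exact L3|]].
  apply is_lim_seq_ext with
    (fun n => snd (u n) * sqrt (fst (u n)) / sqrt (fst (u n))).
    intros n; assert (Hn := sqrt_lt_R0 _ (Uu n)); field; lra.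
  apply is_lim_seq_div'; [exact L4| |simpl; lra].
  apply (is_lim_seq_continuous sqrt); [|exact L3].
  apply continuity_pt_sqrt; lra.
Qed.

(** The eigenvalues of the metric are 4 and 4 a^2 with gamma < a <= 1, so it dominates 4 gamma^2
    times the Euclidean metric off the origin, and by continuity at the origin. The Cartesian
    coordinates are therefore Lipschitz with constant 1 / (2 gamma). *)
Lemma plane_complete lam mu a g : soliton_ode lam mu a -> 0 < 2 * mu / lam ->
  (forall t, 0 < t -> 2 * mu / lam < a t <= 1) -> riemannian plane g ->
  (forall p, punctured_plane p -> forall i j,
    g i j p = radial_metric (fun t => (a t ^ 2 - 1) / t) i j p) ->
  complete_metric plane g.
Proof.
set (gam := 2 * mu / lam); intros Ha Hgam Hb Hg Eg.
assert (LB : forall (v : idx -> R) p, 4 * gam ^ 2 * (v i1 ^ 2 + v i2 ^ 2) <=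
  sum2 (fun i => sum2 (fun j => g i j p * v i * v j))).
  intros v p.
  assert (P : forall q, punctured_plane q -> 0 <=
    sum2 (fun i => sum2 (fun j => g i j q * (v i * v j)))
    - 4 * gam ^ 2 * (v i1 ^ 2 + v i2 ^ 2)).
    intros q Hq; unfold sum2; rewrite !Eg by assumption; unfold radial_metric.
    simpl kronecker; simpl coord.
    assert (Ht := rsq_pos q Hq); specialize (Hb _ Ht); destruct (Ha _ Ht) as [Hp _].
    set (t := rsq q) in *; set (x := fst q); set (y := snd q).
    assert (Et : t = x ^ 2 + y ^ 2) by reflexivity.
    set (V := v i1 ^ 2 + v i2 ^ 2); set (W := (x * v i1 + y * v i2) ^ 2).
    (* The Cauchy-Schwarz inequality, from Lagrange's identity. *)
    assert (HW : W / t <= V).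
      apply Rmult_le_reg_r with t; [assumption|].
      replace (W / t * t) with W by (field; lra).
      pose proof (Rle_0_sqr (x * v i2 - y * v i1)); unfold Rsqr, V, W in *.
      rewrite Et; nra.
    assert (HW0 : 0 <= W / t).
      apply Rmult_le_pos; [apply pow2_ge_0|apply Rlt_le, Rinv_0_lt_compat, Ht].
    replace (_ - _) with (4 * (V - (1 - a t ^ 2) * (W / t)) - 4 * gam ^ 2 * V)
      by (unfold V, W; field; lra).
    assert (a t ^ 2 <= 1) by nra; assert (gam ^ 2 <= a t ^ 2) by nra.
    assert ((1 - a t ^ 2) * (W / t) <= (1 - a t ^ 2) * V) by nra.
    assert (0 <= V) by lra; nra.
  assert (Hp : 0 <= sum2 (fun i => sum2 (fun j => g i j p * (v i * v j)))
    - 4 * gam ^ 2 * (v i1 ^ 2 + v i2 ^ 2)).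
    destruct (Rtotal_order 0 (rsq p)) as [H|H].
      now apply P, punctured_plane_rsq.
    replace p with (0, 0) by (destruct p as [x y]; unfold rsq in H; simpl in H;
      f_equal; nra).
    apply (origin_nonneg (fun q => sum2 (fun i => sum2 (fun j => g i j q * (v i * v j)))
      - 4 * gam ^ 2 * (v i1 ^ 2 + v i2 ^ 2))); [|exact P].
    assert (HU := open_plane); apply (smooth_on_continuous plane); [|exact I].
    apply smooth_minus; trivial; [|now apply smooth_const].
    apply (smooth_sum2 _ HU (fun i q => sum2 (fun j => g i j q * (v i * v j)))).
    intros i; apply (smooth_sum2 _ HU (fun j q => g i j q * (v i * v j))).
    intros j; apply smooth_mult; trivial; [apply Hg|now apply smooth_const].
  unfold sum2 in *; lra.
assert (L : forall i, lipschitz_along_curves plane g (coord i) (/ (2 * gam))).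
  intros i c t _ D; exists (Derive (fun s => coord i (c s)) t).
  split; [now apply Derive_correct|].
  apply Rabs_le_speed; [apply Rlt_le, Rinv_0_lt_compat; lra|].
  assert (Q := LB (fun i => Derive (fun s => coord i (c s)) t) (c t)); cbv beta in Q.
  apply Rmult_le_reg_l with ((2 * gam) ^ 2); [nra|].
  rewrite <- Rmult_assoc.
  replace ((2 * gam) ^ 2 * (/ (2 * gam)) ^ 2) with 1 by (field; lra).
  rewrite Rmult_1_l; eapply Rle_trans; [|exact Q].
  replace ((2 * gam) ^ 2) with (4 * gam ^ 2) by ring.
  apply Rmult_le_compat_l; [nra|].
  destruct i; [pose proof (pow2_ge_0 (Derive (fun s => coord i2 (c s)) t))
    |pose proof (pow2_ge_0 (Derive (fun s => coord i1 (c s)) t))]; lra.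
apply complete_from_coordinates with (3 := L i1) (4 := L i2); trivial.
  apply Rinv_0_lt_compat; lra.
intros u l1 l2 _ L1 L2; exists (l1, l2); split; [exact I|now split].
Qed.

(** * Topology *)

Lemma continuous_pair {T : UniformSpace} (f h : T -> R) x :
  continuous f x -> continuous h x -> continuous (fun y => (f y, h y)) x.
Proof. intros Hf Hh; apply continuous_pt; intros [|]; assumption. Qed.

Lemma continuous_Rplus {T : UniformSpace} (f h : T -> R) x :
  continuous f x -> continuous h x -> continuous (fun y => f y + h y) x.
Proof. apply (continuous_plus f h). Qed.

Lemma continuous_Rminus {T : UniformSpace} (f h : T -> R) x :
  continuous f x -> continuous h x -> continuous (fun y => f y - h y) x.
Proof. apply (continuous_minus f h). Qed.

Lemma continuous_Rmult {T : UniformSpace} (f h : T -> R) x :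
  continuous f x -> continuous h x -> continuous (fun y => f y * h y) x.
Proof. apply (continuous_mult f h). Qed.

Lemma continuous_Rcomp {T : UniformSpace} phi (f : T -> R) x :
  continuity_pt phi (f x) -> continuous f x -> continuous (fun y => phi (f y)) x.
Proof.
intros Hp Hf; apply (continuous_comp f phi); trivial.
now apply continuity_pt_filterlim.
Qed.

Lemma continuous_Rdiv {T : UniformSpace} (f h : T -> R) x : h x <> 0 ->
  continuous f x -> continuous h x -> continuous (fun y => f y / h y) x.
Proof.
intros N Hf Hh; apply continuous_Rmult; trivial.
apply (continuous_Rcomp Rinv); trivial.
apply (continuity_pt_inv (fun x => x)); trivial.
apply continuity_pt_id.
Qed.

Lemma continuous_fst_pt (p : pt) : continuous (fun q : pt => fst q) p.
Proof. apply continuous_fst. Qed.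

Lemma continuous_snd_pt (p : pt) : continuous (fun q : pt => snd q) p.
Proof. apply continuous_snd. Qed.

Lemma continuous_rsq (p : pt) : continuous rsq p.
Proof.
apply (smooth_on_continuous plane); [apply smooth_rsq, open_plane|exact I].
Qed.

Lemma continuity_pt_derive f x d : is_derive f x d -> continuity_pt f x.
Proof.
intros H; apply continuity_pt_filterlim, (ex_derive_continuous f); now exists d.
Qed.

Definition shrink (p : pt) : pt :=
  (fst p / sqrt (1 + rsq p), snd p / sqrt (1 + rsq p)).
Definition unshrink (q : pt) : pt :=
  (fst q / sqrt (1 - rsq q), snd q / sqrt (1 - rsq q)).

Lemma rsq_nonneg p : 0 <= rsq p.
Proof. unfold rsq; nra. Qed.

Lemma rsq_scale p r : r <> 0 -> rsq (fst p / r, snd p / r) = rsq p / r ^ 2.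
Proof. intros; unfold rsq; simpl fst; simpl snd; field; assumption. Qed.

Lemma shrink_inverse : inverse_on plane unit_disc shrink unshrink.
Proof.
split.
- intros p _; assert (H := rsq_nonneg p).
  assert (Hs : 0 < sqrt (1 + rsq p)) by (apply sqrt_lt_R0; lra).
  assert (Es := sqrt_sqrt (1 + rsq p) ltac:(lra)).
  assert (Er : rsq (shrink p) = rsq p / (1 + rsq p)).
    unfold shrink; rewrite rsq_scale by lra; simpl; now rewrite Rmult_1_r, Es.
  split.
    change (rsq (shrink p) < 1); rewrite Er.
    apply Rmult_lt_reg_r with (1 + rsq p); [lra|].
    unfold Rdiv; rewrite Rmult_assoc, Rinv_l by lra; lra.
  unfold unshrink; rewrite Er.
  replace (1 - rsq p / (1 + rsq p)) with (/ (1 + rsq p)) by (field; lra).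
  rewrite sqrt_inv; unfold shrink; destruct p; simpl fst; simpl snd; f_equal; field; lra.
- intros q Hq; change (rsq q < 1) in Hq; assert (H := rsq_nonneg q).
  assert (Hs : 0 < sqrt (1 - rsq q)) by (apply sqrt_lt_R0; lra).
  assert (Es := sqrt_sqrt (1 - rsq q) ltac:(lra)).
  assert (Er : rsq (unshrink q) = rsq q / (1 - rsq q)).
    unfold unshrink; rewrite rsq_scale by lra; simpl; now rewrite Rmult_1_r, Es.
  split; [exact I|].
  unfold shrink; rewrite Er.
  replace (1 + rsq q / (1 - rsq q)) with (/ (1 - rsq q)) by (field; lra).
  rewrite sqrt_inv; unfold unshrink; destruct q; simpl fst; simpl snd; f_equal; field; lra.
Qed.

Lemma continuous_sqrt_rsq e p : 0 < 1 + e * rsq p ->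
  continuous (fun q => sqrt (1 + e * rsq q)) p.
Proof.
intros H; apply (continuous_Rcomp sqrt); [apply continuity_pt_sqrt; lra|].
apply continuous_Rplus; [apply continuous_const|].
apply continuous_Rmult; [apply continuous_const|apply continuous_rsq].
Qed.

Lemma continuous_shrink p : continuous shrink p.
Proof.
assert (H := rsq_nonneg p).
assert (Hs : 0 < sqrt (1 + rsq p)) by (apply sqrt_lt_R0; lra).
assert (K : continuous (fun q => sqrt (1 + rsq q)) p).
  apply continuous_ext with (fun q => sqrt (1 + 1 * rsq q)).
    intros; now rewrite Rmult_1_l.
  apply continuous_sqrt_rsq; lra.
apply continuous_pair; apply continuous_Rdiv; trivial; try lra;
  [apply continuous_fst_pt|apply continuous_snd_pt].
Qed.

Lemma continuous_unshrink q : unit_disc q -> continuous unshrink q.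
Proof.
intros H; change (rsq q < 1) in H.
assert (Hs : 0 < sqrt (1 - rsq q)) by (apply sqrt_lt_R0; lra).
assert (K : continuous (fun q => sqrt (1 - rsq q)) q).
  apply continuous_ext with (fun q => sqrt (1 + -1 * rsq q)).
    intros; f_equal; ring.
  apply continuous_sqrt_rsq; lra.
apply continuous_pair; apply continuous_Rdiv; trivial; try lra;
  [apply continuous_fst_pt|apply continuous_snd_pt].
Qed.

Lemma plane_homeomorphic_disc : homeomorphic plane unit_disc.
Proof.
exists shrink, unshrink; split; [apply shrink_inverse|split].
- apply continuous_on_forall; intros p _; apply continuous_shrink.
- apply continuous_on_forall; intros q Hq; now apply continuous_unshrink.
Qed.

Lemma half_plane_homeomorphic_disc : homeomorphic half_plane unit_disc.
Proof.
exists (fun p => shrink (ln (fst p), snd p)),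
  (fun q => (exp (fst (unshrink q)), snd (unshrink q))).
destruct shrink_inverse as [H1 H2]; split; [split|split].
- intros [x y] Hp; change (fst (x, y)) with x; change (snd (x, y)) with y.
  destruct (H1 (ln x, y) I) as [D E]; split; [exact D|].
  rewrite E; simpl; now rewrite exp_ln.
- intros q Hq; split; [apply exp_pos|].
  cbv beta.
  change (fst (exp (fst (unshrink q)), snd (unshrink q))) with (exp (fst (unshrink q))).
  change (snd (exp (fst (unshrink q)), snd (unshrink q))) with (snd (unshrink q)).
  rewrite ln_exp, <- surjective_pairing; now apply H2.
- apply continuous_on_forall; intros p Hp.
  apply (continuous_comp (fun p => (ln (fst p), snd p)) shrink);
    [|apply continuous_shrink].
  apply continuous_pair; [|apply continuous_snd_pt].
  apply (continuous_Rcomp ln); [|apply continuous_fst_pt].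
  eapply continuity_pt_derive, is_derive_ln, Hp.
- apply continuous_on_forall; intros q Hq.
  assert (K := continuous_unshrink q Hq); apply continuous_pair.
    apply (continuous_Rcomp exp).
      eapply continuity_pt_derive, is_derive_exp.
    apply (continuous_comp unshrink); [exact K|apply continuous_fst_pt].
  apply (continuous_comp unshrink); [exact K|apply continuous_snd_pt].
Qed.

(** * Simple connectedness of the half-plane *)

Definition clamp (t : R) : R := Rmax 0 (Rmin t 1).

Lemma clamp_unit t : unit_interval (clamp t).
Proof.
unfold unit_interval, clamp, Rmax, Rmin.
destruct (Rle_dec t 1), (Rle_dec 0 _); lra.
Qed.

Lemma clamp_id t : unit_interval t -> clamp t = t.
Proof.
unfold unit_interval, clamp, Rmax, Rmin; intros.
destruct (Rle_dec t 1), (Rle_dec 0 _); lra.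
Qed.

Lemma clamp_contracting s t : Rabs (clamp s - clamp t) <= Rabs (s - t).
Proof.
unfold clamp, Rmax, Rmin, Rabs.
destruct (Rle_dec s 1), (Rle_dec t 1); repeat destruct (Rle_dec 0 _);
  repeat destruct (Rcase_abs _); lra.
Qed.

(** [continuous_on] controls limits within the interval only. The clamped path agrees with [c] on
    the interval and is continuous on all of R, so a homotopy built from it is continuous in the
    ordinary sense. *)
Lemma continuous_clamp (c : R -> pt) t : continuous_on unit_interval c ->
  continuous (fun s => c (clamp s)) t.
Proof.
intros Hc; apply filterlim_comp with (2 := Hc _ (clamp_unit t)).
intros P [d Hd]; exists d; intros s Hs; apply Hd; [|apply clamp_unit].
eapply Rle_lt_trans; [apply clamp_contracting|exact Hs].
Qed.

(** By convexity: paths and contractions of loops are straight-line interpolations. *)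
Lemma half_plane_simply_connected : simply_connected half_plane.
Proof.
split; [|split].
- exists (1, 0); apply Rlt_0_1.
- intros p q Hp Hq; unfold half_plane in *.
  exists (fun t => (fst p + t * (fst q - fst p), snd p + t * (snd q - snd p))).
  split; [split|split].
  + apply continuous_on_forall; intros t _.
    apply continuous_pair; apply continuous_Rplus; try apply continuous_const;
      apply continuous_Rmult; try apply continuous_const; apply continuous_id.
  + intros t [Ht0 Ht1]; unfold half_plane; simpl; nra.
  + destruct p; simpl; f_equal; ring.
  + destruct p, q; simpl; f_equal; ring.
- intros c [Hc HU] Hloop.
  set (e := fun t => c (clamp t)).
  assert (Ec : forall t, unit_interval t -> e t = c t).
    intros t Ht; unfold e; now rewrite clamp_id.
  assert (He : forall s : pt, continuous (fun s : pt => e (snd s)) s).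
    intros s; apply (continuous_comp (snd : pt -> R) e); [apply continuous_snd|].
    now apply continuous_clamp.
  assert (He1 : forall s : pt, continuous (fun s : pt => fst (e (snd s))) s).
    intros s; apply (continuous_comp (fun s : pt => e (snd s)) (fst : pt -> R));
      [apply He|apply continuous_fst_pt].
  assert (He2 : forall s : pt, continuous (fun s : pt => snd (e (snd s))) s).
    intros s; apply (continuous_comp (fun s : pt => e (snd s)) (snd : pt -> R));
      [apply He|apply continuous_snd_pt].
  exists (fun s => (fst (e (snd s)) + fst s * (fst (c 0) - fst (e (snd s))),
                    snd (e (snd s)) + fst s * (snd (c 0) - snd (e (snd s))))).
  assert (H0 : unit_interval 0) by (unfold unit_interval; lra).
  assert (H1 : unit_interval 1) by (unfold unit_interval; lra).
  split; [|split; [|split]].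
  + apply continuous_on_forall; intros s _.
    apply continuous_pair; apply continuous_Rplus; trivial;
      apply continuous_Rmult; try apply continuous_fst_pt;
      apply continuous_Rminus; trivial; apply continuous_const.
  + intros [s t] [Hs Ht]; simpl in *; rewrite Ec by assumption.
    assert (P0 := HU 0 H0); assert (Pt := HU t Ht).
    unfold half_plane, unit_interval in *; simpl; nra.
  + intros t Ht; simpl; rewrite Ec by assumption.
    destruct (c t), (c 0); simpl; split; f_equal; ring.
  + intros s Hs; simpl; rewrite !Ec, <- Hloop by assumption.
    destruct (c 0); simpl; split; f_equal; ring.
Qed.

(** * Polar coordinates as a covering of the punctured plane *)

Lemma sin_cos_period_Z x (k : Z) :
  cos (x + 2 * PI * IZR k) = cos x /\ sin (x + 2 * PI * IZR k) = sin x.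
Proof.
assert (N : forall y (n : nat), cos (y + 2 * PI * INR n) = cos y /\
  sin (y + 2 * PI * INR n) = sin y).
  intros y n; replace (2 * PI * INR n) with (2 * INR n * PI) by ring.
  split; [apply cos_period|apply sin_period].
destruct (Z_le_dec 0 k) as [H|H].
  rewrite <- (Z2Nat.id k H), <- INR_IZR_INZ; apply N.
assert (E : x = (x + 2 * PI * IZR k) + 2 * PI * INR (Z.to_nat (- k))).
  rewrite INR_IZR_INZ, Z2Nat.id by lia; rewrite opp_IZR; ring.
split; rewrite E at 2; symmetry; apply N.
Qed.

Lemma cos_pos_branch x : 0 < cos x -> exists k : Z, Rabs (x - 2 * PI * IZR k) < PI / 2.
Proof.
intros Hx; assert (HP := PI_RGT_0).
(* [up z - 1] is the floor of z, so subtracting 2 pi k moves x into [-pi, pi); a positive cosine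
   then forces an absolute value below pi / 2. *)
set (k := (up ((x + PI) / (2 * PI)) - 1)%Z); exists k.
destruct (archimed ((x + PI) / (2 * PI))) as [A1 A2].
assert (Ek : IZR (up ((x + PI) / (2 * PI))) = IZR k + 1).
  unfold k; rewrite minus_IZR; ring.
rewrite Ek in A1, A2.
set (z := (x + PI) / (2 * PI)) in *.
assert (Ez : x = 2 * PI * z - PI) by (unfold z; field; lra).
assert (B : - PI <= x - 2 * PI * IZR k < PI) by (rewrite Ez; nra).
assert (C : cos (x - 2 * PI * IZR k) = cos x).
  replace (x - 2 * PI * IZR k) with (x + 2 * PI * IZR (- k))
    by (rewrite opp_IZR; ring); apply sin_cos_period_Z.
set (w := x - 2 * PI * IZR k) in *.
apply Rabs_def1; apply Rnot_le_lt; intros Hw.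
  assert (cos w <= 0) by (apply cos_le_0; lra); lra.
assert (cos (- w) <= 0) by (apply cos_le_0; lra).
rewrite cos_neg in *; lra.
Qed.

Lemma smooth_map_polar : smooth_map half_plane polar.
Proof.
assert (HU := open_half_plane).
assert (S1 : smooth_on half_plane (fun p => sqrt (fst p))).
  apply (smooth_comp _ HU (fun t => 0 < t) sqrt fst smooth1_sqrt); [trivial|].
  apply (smooth_coord _ HU i1).
assert (S2 : forall u v, smooth_on half_plane (fun p => u * cos (snd p) + v * sin (snd p))).
  intros u v; apply (smooth_comp _ HU (fun _ => True) (fun x => u * cos x + v * sin x) snd);
    [apply smooth1_trig|trivial|apply (smooth_coord _ HU i2)].
intros [|].
- apply smooth_on_ext with
    (fun p => sqrt (fst p) * (1 * cos (snd p) + 0 * sin (snd p))); trivial.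
    intros; unfold polar; simpl; ring.
  now apply smooth_mult.
- apply smooth_on_ext with
    (fun p => sqrt (fst p) * (0 * cos (snd p) + 1 * sin (snd p))); trivial.
    intros; unfold polar; simpl; ring.
  now apply smooth_mult.
Qed.

Lemma continuous_polar p : half_plane p -> continuous polar p.
Proof.
intros Hp; apply (continuous_pt polar).
intros i; apply (smooth_on_continuous half_plane); [apply smooth_map_polar|exact Hp].
Qed.

(* The sections invert [polar] over the half plane of directions making an
   acute angle with [b]. *)
Section Sheets.
Variable b : R.

Let m (q : pt) := fst q * cos b + snd q * sin b.
Let n (q : pt) := snd q * cos b - fst q * sin b.

Definition acute (q : pt) : Prop := 0 < m q.
Definition sheet (k : Z) (p : pt) : Prop :=
  0 < fst p /\ Rabs (snd p - b - 2 * PI * IZR k) < PI / 2.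
Definition section (k : Z) (q : pt) : pt :=
  (rsq q, b + 2 * PI * IZR k + atan (n q / m q)).

Lemma rotate_polar p : m (polar p) = sqrt (fst p) * cos (snd p - b) /\
  n (polar p) = sqrt (fst p) * sin (snd p - b).
Proof. unfold m, n, polar; simpl; rewrite cos_minus, sin_minus; split; ring. Qed.

Lemma rotate_rsq q : m q ^ 2 + n q ^ 2 = rsq q.
Proof.
assert (H := sin2_cos2 b); unfold Rsqr in H.
transitivity (rsq q * (sin b * sin b + cos b * cos b)); [unfold m, n, rsq; ring|].
rewrite H; ring.
Qed.

Lemma continuous_rotate q : continuous m q /\ continuous n q.
Proof.
split; [apply continuous_Rplus|apply continuous_Rminus]; apply continuous_Rmult;
  try apply continuous_const; apply continuous_fst_pt || apply continuous_snd_pt.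
Qed.

Lemma acute_polar p : half_plane p -> (acute (polar p) <-> 0 < cos (snd p - b)).
Proof.
intros Hp; unfold acute; rewrite (proj1 (rotate_polar p)).
assert (Hs := sqrt_lt_R0 _ Hp); split; intros H; [|now apply Rmult_lt_0_compat].
apply Rmult_lt_reg_l with (sqrt (fst p)); lra.
Qed.

Lemma sheet_inverse k : inverse_on (sheet k) acute polar (section k).
Proof.
split.
- intros p [Hp Ha]; set (w := snd p - b - 2 * PI * IZR k) in *.
  assert (Hw := Rabs_def2 _ _ Ha).
  assert (Ew : snd p - b = w + 2 * PI * IZR k) by (unfold w; ring).
  destruct (sin_cos_period_Z w k) as [Ec Es]; rewrite <- Ew in Ec, Es.
  assert (Hc : 0 < cos w) by (apply cos_gt_0; lra).
  split; [apply acute_polar; [exact Hp|lra]|].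
  unfold section; rewrite rsq_polar by exact Hp.
  destruct (rotate_polar p) as [-> ->]; rewrite Ec, Es.
  assert (Hs := sqrt_lt_R0 _ Hp).
  replace (sqrt (fst p) * sin w / (sqrt (fst p) * cos w)) with (tan w)
    by (unfold tan; field; lra).
  rewrite atan_tan by lra; destruct p; unfold w; simpl; f_equal; ring.
- intros q Hq; unfold acute in Hq.
  assert (Hr : 0 < rsq q) by (rewrite <- rotate_rsq; nra).
  set (x := n q / m q); split.
    split; [exact Hr|]; unfold section; simpl; fold x.
    replace (_ - _ - _) with (atan x) by ring.
    destruct (atan_bound x); apply Rabs_def1; lra.
  (* [x] is the tangent of the angle from direction [b] to [q], and m q > 0; this yields the cosine
     and sine of [atan x]. *)
  assert (Hsq : sqrt (1 + x²) = sqrt (rsq q) / m q).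
    rewrite <- (sqrt_Rsqr (m q)) at 1 by lra.
    rewrite <- sqrt_div_alt by (unfold Rsqr; nra); f_equal.
    rewrite <- rotate_rsq; unfold x, Rsqr; field; lra.
  assert (Hs := sqrt_lt_R0 _ Hr).
  unfold polar, section; simpl fst; simpl snd; fold x.
  replace (b + 2 * PI * IZR k + atan x) with (b + atan x + 2 * PI * IZR k) by ring.
  destruct (sin_cos_period_Z (b + atan x) k) as [-> ->].
  rewrite cos_plus, sin_plus, cos_atan, sin_atan, Hsq.
  assert (H := sin2_cos2 b); unfold Rsqr in H.
  destruct q as [q1 q2]; f_equal.
  + transitivity (m (q1, q2) * cos b - n (q1, q2) * sin b); [unfold x; field; lra|].
    transitivity (q1 * (sin b * sin b + cos b * cos b)); [unfold m, n; simpl; ring|].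
    rewrite H; ring.
  + transitivity (m (q1, q2) * sin b + n (q1, q2) * cos b); [unfold x; field; lra|].
    transitivity (q2 * (sin b * sin b + cos b * cos b)); [unfold m, n; simpl; ring|].
    rewrite H; ring.
Qed.

Lemma continuous_section k q : acute q -> continuous (section k) q.
Proof.
intros Hq; unfold acute in Hq; destruct (continuous_rotate q) as [Cm Cn].
apply continuous_pair; [apply continuous_rsq|].
apply continuous_Rplus; [apply continuous_const|].
apply (continuous_Rcomp atan).
  apply derivable_continuous_pt, derivable_pt_atan.
apply continuous_Rdiv; trivial; lra.
Qed.

Lemma open_acute : open acute.
Proof.
apply (open_comp m (fun x => 0 < x)); [|apply open_gt].
intros q _; apply continuous_rotate.
Qed.

Lemma open_sheet k : open (sheet k).
Proof.
apply open_and; [apply open_half_plane|].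
apply (open_comp (fun p : pt => Rabs (snd p - b - 2 * PI * IZR k)) (fun x => x < PI / 2));
  [|apply open_lt].
intros p _; apply (continuous_Rcomp Rabs (fun p : pt => snd p - b - 2 * PI * IZR k));
  [apply Rcontinuity_abs|].
repeat apply continuous_Rminus; try apply continuous_const; apply continuous_snd_pt.
Qed.

End Sheets.

(** Around a point of angle [b] the evenly covered neighbourhood is the open half plane of
    directions at an acute angle to it. Over it the angle is determined up to multiples of 2 pi, so
    the sheets are indexed by Z. *)
Lemma polar_covering : covering_map half_plane polar punctured_plane.
Proof.
split; [|split; [|split]].
- apply continuous_on_forall; intros p; apply continuous_polar.
- apply polar_punctured.
- apply polar_surjective.
- intros q Hq; destruct (polar_surjective q Hq) as [p [Hp <-]].
  set (b := snd p); exists (acute b); split; [apply open_acute|split; [|split]].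
  + apply acute_polar; trivial; unfold b; rewrite Rminus_diag, cos_0; apply Rlt_0_1.
  + intros r Hr ->; unfold acute in Hr; simpl in Hr; lra.
  + exists Z, (sheet b); split; [apply open_sheet|split; [|split]].
    * intros k l e [_ H1] [_ H2]; apply Rabs_def2 in H1, H2.
      assert (HP := PI_RGT_0).
      (* One angle lies within pi / 2 of both b + 2 pi k and b + 2 pi l, so these differ by less
         than pi. *)
      assert (K : -1 < IZR (k - l) < 1) by (rewrite minus_IZR; nra).
      destruct K as [K1 K2]; apply lt_IZR in K1, K2; lia.
    * intros e; split.
        intros [He Ha]; apply acute_polar in Ha; trivial.
        destruct (cos_pos_branch _ Ha) as [k Hk]; exists k; now split.
      intros [k Hk]; split; [apply Hk|].
      now apply (sheet_inverse b k).
    * intros k; exists (section b k); split; [apply sheet_inverse|].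
      apply continuous_on_forall; intros r; apply continuous_section.
Qed.

(** * The soliton equation for [a] *)

Lemma within_proper (I : R -> Prop) t : I t -> ProperFilter (within I (locally t)).
Proof.
intros It; constructor.
  intros P HP; exists t; exact (locally_singleton _ _ HP It).
apply within_filter, locally_filter.
Qed.

Lemma soliton_rhs lam mu x : lam <> 0 -> mu <> 0 ->
  4 * mu * x ^ 2 * (x / (2 * mu / lam) - 1) = 2 * lam * x ^ 3 - 4 * mu * x ^ 2.
Proof. intros; field; split; assumption. Qed.

(** A point t > 0 is interior to [I], so the derivative within [I] is the ordinary one there. *)
Lemma solution_on_soliton_ode lam mu (I : R -> Prop) a : lam <> 0 -> mu <> 0 ->
  (forall t, 0 < t -> I t) -> solution_on lam mu I a -> soliton_ode lam mu a.
Proof.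
intros Hl Hm HI Ha t Ht; destruct (Ha t (HI t Ht)) as [Hp [HL HD]].
rewrite (soliton_rhs lam mu _ Hl Hm) in *.
split; [assumption|split; [exact HL|]].
intros x Hx; assert (E : t = x)
  by exact (@is_filter_lim_locally_unique _ R_NormedModule t x Hx); subst x.
assert (Hlim : is_filter_lim (within I (locally t)) t).
  intros P HP; apply filter_le_within, HP.
intros eps; assert (W := HD t Hlim eps); unfold within in W.
generalize (filter_and _ _ W (open_gt 0 t Ht)); apply filter_imp; intros y [H1 H2]; apply H1, HI, H2.
Qed.

Lemma soliton_ode_solution_on lam mu (I : R -> Prop) a : lam <> 0 -> mu <> 0 ->
  (forall t, I t -> 0 < a t /\ is_derive a t (2 * lam * a t ^ 3 - 4 * mu * a t ^ 2)) ->
  solution_on lam mu I a.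
Proof.
intros Hl Hm Ha t It; destruct (Ha t It) as [Hp Da]; split; [assumption|].
rewrite (soliton_rhs lam mu _ Hl Hm).
apply (@filterdiff_locally _ _ _ _ (within_proper I t It) a t).
  intros P HP; apply filter_le_within, HP.
exact Da.
Qed.

(** The equation reads (a - gamma)' = q (a - gamma) with q = 2 lam a^2, so (a - gamma) exp (-
    integral of q) is constant and the sign of a - gamma never changes. A point s < t where a >
    gamma is supplied by the behaviour of [a] at 0. *)
Lemma soliton_ode_above lam mu a : soliton_ode lam mu a -> lam < 0 ->
  (forall t, 0 < t -> exists s, 0 < s < t /\ 2 * mu / lam < a s) ->
  forall t, 0 < t -> 2 * mu / lam < a t.
Proof.
intros Ha Hl Hs t Ht; destruct (Hs t Ht) as [s [Hst Has]].
set (q := fun x => 2 * lam * a x ^ 2).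
set (gam := 2 * mu / lam) in *.
assert (Cq : forall x, 0 < x -> continuous q x).
  intros x Hx; destruct (Ha x Hx) as [_ Da].
  apply (continuous_scal_r (2 * lam) (fun x => a x ^ 2)).
  apply (ex_derive_continuous (fun x => a x ^ 2)); auto_derive.
  now exists (2 * lam * a x ^ 3 - 4 * mu * a x ^ 2).
assert (Dq : forall x, 0 < x -> is_derive (RInt q s) x (q x)).
  intros x Hx; apply (is_derive_RInt q _ s x); [|now apply Cq].
  generalize (open_gt 0 x Hx); apply filter_imp; intros y Hy.
  apply (@RInt_correct R_CompleteNormedModule), (@ex_RInt_continuous R_CompleteNormedModule).
  intros z Hz; apply Cq; destruct Hz as [Hz _].
  apply Rlt_le_trans with (2 := Hz), Rmin_glb_lt; lra.
assert (E : (a s - gam) * exp (- RInt q s s) = (a t - gam) * exp (- RInt q s t)).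
  apply (eq_is_derive (fun x => (a x - gam) * exp (- RInt q s x))); [|lra].
  intros x Hx; destruct (Ha x ltac:(lra)) as [Hp Da].
  specialize (Dq x ltac:(lra)).
  assert (D : is_derive (fun x => (a x - gam) * exp (- RInt q s x)) x
    ((2 * lam * a x ^ 3 - 4 * mu * a x ^ 2) * exp (- RInt q s x)
     + (a x - gam) * (- q x * exp (- RInt q s x)))).
    apply (is_derive_mult (fun x => a x - gam) (fun x => exp (- RInt q s x)));
      [| |intros; apply Rmult_comm].
      replace (2 * lam * a x ^ 3 - 4 * mu * a x ^ 2)
        with (minus (2 * lam * a x ^ 3 - 4 * mu * a x ^ 2) 0)
        by (unfold minus, plus, opp; simpl; ring).
      apply (is_derive_minus a (fun _ => gam)); [exact Da|apply (is_derive_const gam)].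
    apply (is_derive_comp exp (fun x => - RInt q s x)); [apply is_derive_exp|].
    apply (is_derive_opp (RInt q s)), Dq.
  assert (Z : (2 * lam * a x ^ 3 - 4 * mu * a x ^ 2) * exp (- RInt q s x)
     + (a x - gam) * (- q x * exp (- RInt q s x)) = 0).
    unfold q, gam; field; lra.
  rewrite Z in D; exact D.
assert (P1 := exp_pos (- RInt q s s)); assert (P2 := exp_pos (- RInt q s t)).
assert (0 < (a t - gam) * exp (- RInt q s t)) by (rewrite <- E; nra).
nra.
Qed.

Lemma MVT_pos (f df : R -> R) s t : 0 < s <= t ->
  (forall x, 0 < x -> is_derive f x (df x)) ->
  exists c, s <= c <= t /\ f t - f s = df c * (t - s).
Proof.
intros Hst D; destruct (MVT_gen f s t df) as [c [Hc E]].
- rewrite Rmin_left by lra; intros x Hx; apply D; lra.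
- rewrite Rmin_left by lra; intros x Hx; apply continuity_pt_filterlim.
  apply (ex_derive_continuous f); exists (df x); apply D; lra.
- rewrite Rmin_left, Rmax_right in Hc by lra; now exists c.
Qed.

Lemma soliton_ode_nonincreasing lam mu a : soliton_ode lam mu a -> lam < 0 ->
  (forall t, 0 < t -> 2 * mu / lam < a t) ->
  forall s t, 0 < s <= t -> a t <= a s.
Proof.
intros Ha Hl Hb s t Hst.
destruct (MVT_pos a (fun x => 2 * lam * a x ^ 3 - 4 * mu * a x ^ 2) s t Hst)
  as [c [Hc E]]; [intros x Hx; apply (Ha x Hx)|].
specialize (Hb c ltac:(lra)); destruct (Ha c ltac:(lra)) as [Hp _].
assert (2 * lam * a c ^ 3 - 4 * mu * a c ^ 2 <= 0).
  replace (2 * lam * a c ^ 3 - 4 * mu * a c ^ 2)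
    with (- ((- (2 * lam)) * a c ^ 2 * (a c - 2 * mu / lam))) by (field; lra).
  assert (0 <= - (2 * lam) * a c ^ 2 * (a c - 2 * mu / lam)); [|lra].
  repeat apply Rmult_le_pos; try lra; nra.
nra.
Qed.

(** For lam = -1 the function 1 / a^2 has derivative 4 + 8 mu / a <= 4 and tends to 0 at t = 0,
    hence 1 / a^2 <= 4 t. *)
Lemma soliton_ode_blowup_rate mu a : soliton_ode (-1) mu a -> mu < 0 ->
  filterlim a (at_right 0) (Rbar_locally p_infty) ->
  forall t, 0 < t -> 1 <= 4 * t * a t ^ 2.
Proof.
intros Ha Hm Hlim t Ht; destruct (Ha t Ht) as [Hp _].
assert (K : / a t ^ 2 <= 4 * t).
  apply Rle_plus_epsilon; intros eps Heps.
  (* From a > 1 and a > 1 / eps it follows that a^2 > 1 / eps. *)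
  assert (Hev : at_right 0 (fun s => Rmax 1 (/ eps) < a s)).
    apply Hlim; now exists (Rmax 1 (/ eps)).
  destruct Hev as [d Hd]; assert (Hd0 := cond_pos d).
  set (s := Rmin (d / 2) t).
  assert (Hs0 : 0 < s) by (apply Rmin_pos; lra).
  assert (Hst : s <= t) by apply Rmin_r.
  assert (Hsd : s <= d / 2) by apply Rmin_l.
  assert (Hs : Rmax 1 (/ eps) < a s).
    apply Hd; [|exact Hs0].
    unfold ball; simpl; unfold AbsRing_ball, abs, minus, plus, opp; simpl.
    rewrite Rabs_right; lra.
  assert (M1 := Rmax_l 1 (/ eps)); assert (M2 := Rmax_r 1 (/ eps)).
  assert (Hsm : / a s ^ 2 <= eps).
    rewrite <- (Rinv_inv eps); apply Rinv_le_contravar.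
      now apply Rinv_0_lt_compat.
    nra.
  destruct (MVT_pos (fun x => / a x ^ 2) (fun x => 4 + 8 * mu / a x) s t (conj Hs0 Hst))
    as [c [Hc E]].
    intros x Hx; destruct (Ha x Hx) as [Hpx Da].
    assert (ED : Derive (fun x => a x) x = 2 * -1 * a x ^ 3 - 4 * mu * a x ^ 2)
      by (apply is_derive_unique, Da).
    auto_derive; [repeat split; [eexists; exact Da|apply Rgt_not_eq; nra]|].
    rewrite ED; field; lra.
  destruct (Ha c ltac:(lra)) as [Hpc _].
  assert (4 + 8 * mu / a c <= 4).
    assert (0 <= - (8 * mu) * / a c); [|unfold Rdiv; lra].
    apply Rmult_le_pos; [lra|apply Rlt_le, Rinv_0_lt_compat, Hpc].
  nra.
assert (P : 0 < a t ^ 2) by nra.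
apply Rmult_le_reg_r with (/ a t ^ 2); [now apply Rinv_0_lt_compat|].
replace (4 * t * a t ^ 2 * / a t ^ 2) with (4 * t) by (field; lra); lra.
Qed.

(** * Explicit solutions *)

(* With [a = gam / (1 - exp (- z))], the soliton ODE integrates to
   [excess z = - 2 lam gam^2 t + const]. *)
Definition excess (z : R) : R := z - 1 + exp (- z).

Lemma is_derive_excess z : is_derive excess z (1 - exp (- z)).
Proof. unfold excess; auto_derive; trivial; ring. Qed.

Lemma exp_neg_lt_1 z : 0 < z -> exp (- z) < 1.
Proof. intros Hz; rewrite <- exp_0; apply exp_increasing; lra. Qed.

Lemma excess_0 : excess 0 = 0.
Proof. unfold excess; rewrite Ropp_0, exp_0; ring. Qed.

(** With h = y - x, the increment is h - exp (- x) (1 - exp (- h)), which is positive because 1 -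
    exp (- h) < h and exp (- x) <= 1. *)
Lemma excess_increasing x y : 0 <= x -> x < y -> excess x < excess y.
Proof.
intros Hx Hxy.
assert (Hd := exp_ineq1 (- (y - x)) ltac:(lra)); assert (Hd1 := exp_neg_lt_1 (y - x) ltac:(lra)).
assert (Ex : exp (- x) <= 1).
  destruct Hx as [Hx| <-]; [apply Rlt_le, exp_neg_lt_1, Hx|rewrite Ropp_0, exp_0; lra].
unfold excess; replace (- y) with (- x + - (y - x)) by ring; rewrite exp_plus.
assert (Px := exp_pos (- x)); nra.
Qed.

Lemma excess_inverse : exists Z : R -> R,
  forall tau, 0 <= tau -> 0 <= Z tau /\ excess (Z tau) = tau.
Proof.
assert (S : forall tau, {z | 0 <= tau -> 0 <= z /\ excess z = tau}).
  intros tau; destruct (Rle_dec 0 tau) as [H|H]; [|exists 0; tauto].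
  (* The upper end is large enough: [excess (tau + 1)] is tau + exp (- (tau + 1)). *)
  destruct (IVT_gen excess 0 (tau + 1) tau) as [z [Hz E]].
  - intros z; apply continuity_pt_filterlim, (ex_derive_continuous excess).
    eexists; apply is_derive_excess.
  - rewrite excess_0; assert (P := exp_pos (- (tau + 1))).
    rewrite Rmin_left, Rmax_right; unfold excess; lra.
  - exists z; intros _; split; [|exact E].
    rewrite Rmin_left in Hz; lra.
exists (fun tau => proj1_sig (S tau)); intros tau; apply (proj2_sig (S tau)).
Qed.

Section Inverse.
Variables (Z : R -> R)
  (HZ : forall tau, 0 <= tau -> 0 <= Z tau /\ excess (Z tau) = tau).

Lemma inverse_excess z : 0 <= z -> Z (excess z) = z.
Proof.
intros Hz; assert (P : 0 <= excess z).
  unfold excess; pose proof (exp_ineq1_le (- z)); lra.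
destruct (HZ _ P) as [H1 H2].
destruct (Rtotal_order (Z (excess z)) z) as [H|[H|H]]; [|assumption|];
  [pose proof (excess_increasing _ _ H1 H)|pose proof (excess_increasing _ _ Hz H)]; lra.
Qed.

Lemma inverse_excess_lt tau z : 0 <= tau -> 0 <= z -> tau < excess z -> Z tau < z.
Proof.
intros Ht Hz H; destruct (HZ tau Ht) as [H1 H2]; apply Rnot_le_lt; intros Hn.
destruct (Rle_lt_or_eq_dec _ _ Hn) as [Hl|Hl].
  pose proof (excess_increasing _ _ Hz Hl); lra.
rewrite <- Hl in H2; lra.
Qed.

Lemma inverse_excess_pos tau : 0 < tau -> 0 < Z tau.
Proof.
intros Ht; destruct (HZ tau ltac:(lra)) as [[H|H] E]; [assumption|].
rewrite <- H, excess_0 in E; lra.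
Qed.

(** The inverse function theorem on [0, tau + 1] gives differentiability, and differentiating excess
    (Z x) = x gives the value. At tau = 0 the slope of [excess] vanishes, which is the source of the
    blow-up of [a]. *)
Lemma is_derive_inverse_excess tau : 0 < tau ->
  is_derive Z tau (/ (1 - exp (- Z tau))).
Proof.
intros Ht; assert (Pz := inverse_excess_pos tau Ht).
assert (He := exp_neg_lt_1 _ Pz).
assert (D : ex_derive Z tau).
  apply ex_derive_Reals_1.
  assert (Hub : tau < excess (tau + 1)).
    unfold excess; pose proof (exp_pos (- (tau + 1))); lra.
  assert (Hen : excess 0 < tau < excess (tau + 1)) by (rewrite excess_0; lra).
  assert (Hwf : forall x, excess 0 <= x -> x <= excess (tau + 1) -> 0 <= Z x <= tau + 1).
    rewrite excess_0; intros x H0 H1; split; [apply HZ; lra|].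
    destruct H1 as [H1| ->]; [apply Rlt_le, inverse_excess_lt; lra|].
    rewrite inverse_excess; lra.
  assert (Hder : forall x, 0 <= x <= tau + 1 -> derivable_pt excess x).
    intros x _; apply ex_derive_Reals_0; eexists; apply is_derive_excess.
  apply (derivable_pt_recip_interv excess Z 0 (tau + 1) tau ltac:(lra) Hen) with Hwf Hder.
  - rewrite excess_0; intros x H0 _; apply HZ, H0.
  - intros x y H0 Hxy _; now apply excess_increasing.
  - rewrite (derive_pt_eq_0 _ _ (1 - exp (- Z tau))); [lra|].
    apply is_derive_Reals, is_derive_excess.
assert (E : Derive Z tau * (1 - exp (- Z tau)) = 1).
  transitivity (Derive (fun x => excess (Z x)) tau).
    symmetry; apply is_derive_unique.
    apply (is_derive_comp excess Z); [apply is_derive_excess|now apply Derive_correct].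
  apply is_derive_unique, is_derive_ext_loc with (fun x => x);
    [|apply (is_derive_id (K := R_AbsRing))].
  generalize (open_gt 0 tau Ht); apply filter_imp; intros x Hx; symmetry.
  apply HZ; lra.
replace (/ (1 - exp (- Z tau))) with (Derive Z tau); [now apply Derive_correct|].
apply Rmult_eq_reg_r with (1 - exp (- Z tau)); [|lra].
rewrite E; field; lra.
Qed.

(** The parameter [tau0] is the value of [excess z] at t = 0 and encodes the initial condition: 0
    gives blow-up at t = 0, a positive value gives a finite a(0). *)
Definition soliton_solution (lam gam tau0 t : R) : R :=
  gam / (1 - exp (- Z (tau0 - 2 * lam * gam ^ 2 * t))).

Lemma soliton_solution_derive lam mu gam tau0 t : 0 < gam -> 2 * mu = lam * gam ->
  0 < tau0 - 2 * lam * gam ^ 2 * t ->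
  let a := soliton_solution lam gam tau0 in
  0 < a t /\ is_derive a t (2 * lam * a t ^ 3 - 4 * mu * a t ^ 2).
Proof.
intros Hg Hm Ht a; unfold a, soliton_solution.
assert (Pz := inverse_excess_pos _ Ht); assert (He := exp_neg_lt_1 _ Pz).
assert (D := is_derive_inverse_excess _ Ht).
split; [apply Rdiv_lt_0_compat; lra|].
set (tau := tau0 - 2 * lam * gam ^ 2 * t) in *.
assert (D' : is_derive (fun s => Z (tau0 - 2 * lam * gam ^ 2 * s)) t
  (- (2 * lam * gam ^ 2) * / (1 - exp (- Z tau)))).
  apply (is_derive_comp Z (fun s => tau0 - 2 * lam * gam ^ 2 * s)); [exact D|].
  auto_derive; trivial; ring.
set (z := fun s => Z (tau0 - 2 * lam * gam ^ 2 * s)) in *.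
change (Z tau) with (z t) in *.
assert (ED : Derive (fun x => z x) t = - (2 * lam * gam ^ 2) * / (1 - exp (- z t)))
  by (apply is_derive_unique, D').
apply (is_derive_ext (fun s => gam / (1 - exp (- z s)))); [reflexivity|].
auto_derive; [split; [eexists; exact D'|lra]|].
rewrite ED; replace (4 * mu) with (2 * (lam * gam)) by (rewrite <- Hm; ring).
field; lra.
Qed.

Lemma soliton_solution_blowup lam gam : lam < 0 -> 0 < gam ->
  filterlim (soliton_solution lam gam 0) (at_right 0) (Rbar_locally p_infty).
Proof.
intros Hl Hg P [M HM].
(* For 0 < z < zeta one has 1 - exp (- z) <= z < zeta, hence a >= |M| + 1. *)
set (zeta := gam / (Rabs M + 1)).
assert (HM0 := Rabs_pos M); assert (HM1 := Rle_abs M).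
assert (Pz : 0 < zeta) by (apply Rdiv_lt_0_compat; lra).
assert (Pe : 0 < excess zeta) by (rewrite <- excess_0; apply excess_increasing; lra).
set (c := - (2 * lam * gam ^ 2)).
assert (Pc : 0 < c).
  unfold c; assert (0 < gam ^ 2) by nra; nra.
assert (Pd : 0 < excess zeta / c) by now apply Rdiv_lt_0_compat.
exists (mkposreal _ Pd); intros t Ht Ht0; apply HM.
unfold ball in Ht; simpl in Ht; unfold AbsRing_ball, abs, minus, plus, opp in Ht.
simpl in Ht; rewrite Ropp_0, Rplus_0_r, Rabs_right in Ht by lra.
unfold soliton_solution.
replace (0 - 2 * lam * gam ^ 2 * t) with (c * t) by (unfold c; ring).
assert (Hct : 0 < c * t) by now apply Rmult_lt_0_compat.
assert (Hz0 := inverse_excess_pos _ Hct).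
assert (Hz : Z (c * t) < zeta).
  apply inverse_excess_lt; try lra.
  apply Rmult_lt_compat_l with (r := c) in Ht; [|assumption].
  replace (c * (excess zeta / c)) with (excess zeta) in Ht by (field; lra); lra.
set (z := Z (c * t)) in *; assert (He := exp_neg_lt_1 z Hz0).
assert (Hi := exp_ineq1_le (- z)).
apply Rle_lt_trans with (1 := HM1), Rlt_le_trans with (Rabs M + 1); [lra|].
apply Rmult_le_reg_r with (1 - exp (- z)); [lra|].
replace (gam / (1 - exp (- z)) * (1 - exp (- z))) with gam by (field; lra).
apply Rle_trans with ((Rabs M + 1) * zeta); [apply Rmult_le_compat_l; lra|].
unfold zeta; right; field; lra.
Qed.

(** Solving gam / (1 - exp (- z)) = 1 gives z = - ln (1 - gam), which is where gam < 1 enters. *)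
Lemma soliton_solution_initial lam gam : 0 < gam < 1 ->
  let tau0 := excess (- ln (1 - gam)) in
  0 < tau0 /\ soliton_solution lam gam tau0 0 = 1.
Proof.
intros Hg tau0.
assert (Hz : 0 < - ln (1 - gam)).
  assert (ln (1 - gam) < 0); [|lra].
  rewrite <- ln_1; apply ln_increasing; lra.
split.
  unfold tau0; rewrite <- excess_0; apply excess_increasing; lra.
unfold soliton_solution; replace (tau0 - _) with tau0 by ring.
unfold tau0; rewrite inverse_excess, Ropp_involutive, exp_ln by lra; field; lra.
Qed.

End Inverse.

(* Hadamard's lemma: [k t] is the integral of [f' (s t)] over [0 <= s <= 1]. *)
Lemma smooth1_quotient (J : R -> Prop) f : open J ->
  (forall t s, J t -> 0 <= s <= 1 -> J (s * t)) -> smooth1 J f ->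
  exists k, smooth1 J k /\ forall t, J t -> f t = f 0 + t * k t.
Proof.
intros HJ Hstar [P [Pf HP]]; destruct (HP f Pf) as [f' [Pf' Df]].
assert (C : forall h, P h -> forall x, J x -> continuous h x).
  intros h Ph x Jx; destruct (HP h Ph) as [h' [_ Dh]].
  apply (ex_derive_continuous h); exists (h' x); auto.
assert (CI : forall h n t s, P h -> J (s * t) -> continuous (fun s => s ^ n * h (s * t)) s).
  intros h n t s Ph Js; apply (continuous_mult (fun s => s ^ n) (fun s => h (s * t))).
    apply (ex_derive_continuous (fun s => s ^ n)); auto_derive; trivial.
  apply (continuous_comp (fun s => s * t) h); [|now apply C].
  apply (ex_derive_continuous (fun s => s * t)); auto_derive; trivial.
assert (EI : forall h n t, P h -> J t -> ex_RInt (fun s => s ^ n * h (s * t)) 0 1).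
  intros h n t Ph Jt; apply (@ex_RInt_continuous R_CompleteNormedModule).
  rewrite Rmin_left, Rmax_right by lra; intros s Hs; apply CI; auto.
exists (fun t => RInt (fun s => s ^ 0 * f' (s * t)) 0 1); split.
(* Differentiating under the integral replaces h by h' and raises the power of s by one, so these
   weighted averages of members of [P] form a closed class; [s ^ 0] puts the quotient itself into
   that shape. *)
- exists (fun g => exists n h, P h /\ g = fun t => RInt (fun s => s ^ n * h (s * t)) 0 1).
  split; [now exists 0%nat, f'|].
  intros g [n [h [Ph ->]]]; destruct (HP h Ph) as [h' [Ph' Dh]].
  exists (fun t => RInt (fun s => s ^ S n * h' (s * t)) 0 1).
  split; [now exists (S n), h'|]; intros t Jt.
  assert (DI : forall s u, J (s * u) ->
    is_derive (fun z => s ^ n * h (s * z)) u (s ^ S n * h' (s * u))).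
    intros s u Jsu; replace (s ^ S n * h' (s * u)) with (s ^ n * (s * h' (s * u)))
      by (simpl; ring).
    apply (is_derive_scal (fun z => h (s * z)) u (s ^ n)).
    apply (is_derive_comp h (fun z => s * z)); [now apply Dh|].
    auto_derive; trivial; ring.
  replace (RInt (fun s => s ^ S n * h' (s * t)) 0 1)
    with (RInt (fun s => Derive (fun z => s ^ n * h (s * z)) t) 0 1).
  2: { apply RInt_ext; rewrite Rmin_left, Rmax_right by lra; intros s Hs.
    apply is_derive_unique, DI, Hstar; trivial; lra. }
  apply (is_derive_RInt_param (fun u s => s ^ n * h (s * u)) 0 1 t).
  + generalize (HJ t Jt); apply filter_imp; intros u Ju s Hs.
    rewrite Rmin_left, Rmax_right in Hs by lra.
    exists (s ^ S n * h' (s * u)); apply DI; auto.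
  + rewrite Rmin_left, Rmax_right by lra; intros s Hs.
    assert (Jst : J (s * t)) by auto.
    assert (Cm : continuous (fun q : R * R => snd q * fst q) (t, s)).
      apply (continuous_mult (fun q : R * R => snd q) (fun q : R * R => fst q));
        [apply continuous_snd|apply continuous_fst].
    apply continuity_2d_pt_ext_loc with (fun u v => v ^ S n * h' (v * u)).
      apply locally_2d_locally.
      assert (W := Cm _ (HJ _ Jst)); unfold filtermap in W; revert W.
      apply filter_imp; intros [u v] Juv; symmetry.
      apply is_derive_unique, DI, Juv.
    apply continuity_2d_pt_filterlim.
    apply (continuous_mult (fun q : R * R => snd q ^ S n)
      (fun q : R * R => h' (snd q * fst q)) (t, s)).
      apply (continuous_comp (fun q : R * R => snd q) (fun x => x ^ S n)).
        apply continuous_snd.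
      apply (ex_derive_continuous (fun x => x ^ S n)); auto_derive; trivial.
    apply (continuous_comp (fun q : R * R => snd q * fst q) h'); [exact Cm|].
    now apply C.
  + generalize (HJ t Jt); apply filter_imp; intros u Ju; now apply EI.
- intros t Jt.
  assert (I1 : is_RInt (fun s => t * (s ^ 0 * f' (s * t))) 0 1 (f (1 * t) - f (0 * t))).
    apply (is_RInt_derive (fun s => f (s * t))).
    + rewrite Rmin_left, Rmax_right by lra; intros s Hs.
      replace (t * (s ^ 0 * f' (s * t))) with (t * f' (s * t)) by (simpl; ring).
      apply (is_derive_comp f (fun s => s * t)); [now apply Df, Hstar|].
      auto_derive; trivial; ring.
    + rewrite Rmin_left, Rmax_right by lra; intros s Hs.
      apply (continuous_scal_r t (fun s => s ^ 0 * f' (s * t))), CI; auto.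
  assert (I2 : is_RInt (fun s => t * (s ^ 0 * f' (s * t))) 0 1
    (t * RInt (fun s => s ^ 0 * f' (s * t)) 0 1)).
    apply (is_RInt_scal (fun s => s ^ 0 * f' (s * t)) 0 1 t).
    now apply (@RInt_correct R_CompleteNormedModule), EI.
  assert (E : f (1 * t) - f (0 * t) = t * RInt (fun s => s ^ 0 * f' (s * t)) 0 1).
    rewrite <- (is_RInt_unique _ _ _ _ I1); apply is_RInt_unique, I2.
  rewrite Rmult_1_l, Rmult_0_l in E; lra.
Qed.

(** * The two families *)

(** Splitting v into angular and radial parts, t times the quadratic form is 4 times the square of
    (x v2 - y v1) plus 4 (1 + t k) times the square of (x v1 + y v2). At t = 0 the form is 4 times
    the Euclidean one. *)
Lemma radial_riemannian U k : open U -> smooth_on U (fun p => k (rsq p)) ->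
  (forall p, U p -> 0 < 1 + rsq p * k (rsq p)) -> riemannian U (radial_metric k).
Proof.
intros HU Sk Hk; split; [assumption|split; [|split]].
- intros i j; apply smooth_mult; trivial; [now apply smooth_const|].
  apply smooth_plus; trivial; [now apply smooth_const|].
  repeat apply smooth_mult; trivial; now apply smooth_coord.
- intros p _; unfold radial_metric; simpl; ring.
- intros [x y] Up v Hv; specialize (Hk _ Up); unfold sum2, radial_metric.
  assert (V : 0 < v i1 ^ 2 + v i2 ^ 2).
    destruct Hv as [[|] Hv]; pose proof (pow2_ge_0 (v i1)); pose proof (pow2_ge_0 (v i2));
      pose proof (pow2_gt_0 _ Hv); lra.
  set (c := k (rsq (x, y))) in *.
  assert (Er : rsq (x, y) = x ^ 2 + y ^ 2) by reflexivity.
  set (t := rsq (x, y)) in *; simpl kronecker; simpl coord.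
  set (S := v i1 ^ 2 + v i2 ^ 2 + c * (x * v i1 + y * v i2) ^ 2).
  replace (_ + _) with (4 * S) by (unfold S; ring).
  destruct (Rtotal_order 0 t) as [Ht|Ht].
  + assert (Et : t * S = (x * v i2 - y * v i1) ^ 2
      + (1 + t * c) * (x * v i1 + y * v i2) ^ 2) by (unfold S; rewrite Er; ring).
    assert (E : t * (v i1 ^ 2 + v i2 ^ 2) = (x * v i2 - y * v i1) ^ 2
      + (x * v i1 + y * v i2) ^ 2) by (rewrite Er; ring).
    assert (0 < t * (v i1 ^ 2 + v i2 ^ 2)) by now apply Rmult_lt_0_compat.
    assert (Q1 := pow2_ge_0 (x * v i2 - y * v i1)).
    assert (Q2 := pow2_ge_0 (x * v i1 + y * v i2)).
    set (A := (x * v i2 - y * v i1) ^ 2) in *; set (B := (x * v i1 + y * v i2) ^ 2) in *.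
    assert (0 < t * S).
      rewrite Et; destruct Q2 as [Q2|Q2]; [|rewrite <- Q2 in *; lra].
      assert (0 < (1 + t * c) * B) by now apply Rmult_lt_0_compat.
      lra.
    nra.
  + assert (x = 0 /\ y = 0) as [-> ->] by (rewrite Er in Ht; split; nra).
    unfold S; nra.
Qed.

Lemma g7_exists nu lam mu : 2 * PI < nu -> lam < 0 -> mu < 0 ->
  2 * mu / lam = 2 * PI / nu -> exists g, is_g7 nu lam mu g.
Proof.
intros Hnu Hl Hm E; assert (HP := PI_RGT_0).
set (gam := 2 * PI / nu) in *.
assert (Hg : 0 < gam < 1).
  split; [apply Rdiv_lt_0_compat; lra|].
  apply Rmult_lt_reg_r with nu; [lra|]; unfold gam; field_simplify; lra.
assert (Hmu : 2 * mu = lam * gam) by (rewrite <- E; field; lra).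
destruct excess_inverse as [Z HZ].
destruct (soliton_solution_initial Z HZ lam gam Hg) as [Ht0 Ha0].
set (tau0 := excess (- ln (1 - gam))) in *.
set (a := soliton_solution Z lam gam tau0) in *.
(* Since tau0 > 0, the solution continues past t = 0 and [J] is an open half-line containing [0,
   oo); at t = 0 the quotient (a^2 - 1) / t can then be treated with two-sided derivatives. *)
set (J := fun t => 0 < tau0 - 2 * lam * gam ^ 2 * t).
assert (Da : forall t, J t -> 0 < a t /\
  is_derive a t (2 * lam * a t ^ 3 - 4 * mu * a t ^ 2)).
  intros t Jt; apply (soliton_solution_derive Z HZ lam mu gam tau0 t); trivial; lra.
assert (Hc : 0 < - (2 * lam * gam ^ 2)).
  assert (0 < gam ^ 2) by nra; nra.
assert (J0 : forall t, 0 <= t -> J t).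
  intros t Ht; unfold J; nra.
assert (OJ : open J).
  apply (open_comp (fun t => tau0 - 2 * lam * gam ^ 2 * t) (fun x => 0 < x));
    [|apply open_gt].
  intros t _; apply (ex_derive_continuous (fun t => tau0 - 2 * lam * gam ^ 2 * t)).
  auto_derive; trivial.
assert (S2 : smooth1 J (fun t => a t * a t)).
  apply (smooth1_soliton_ode lam mu J a); [apply Da|].
  apply polynomial_mult; constructor.
destruct (smooth1_quotient J (fun t => a t * a t) OJ) as [k [Sk Ek]]; trivial.
  intros t s Jt Hs; unfold J in *.
  (* The argument of [Z] is affine in t, so its value at s t is a convex combination of its values
     at 0 and t. *)
  replace (tau0 - 2 * lam * gam ^ 2 * (s * t))
    with ((1 - s) * tau0 + s * (tau0 - 2 * lam * gam ^ 2 * t)) by ring.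
  set (w := tau0 - 2 * lam * gam ^ 2 * t) in *.
  destruct (Rle_lt_dec s (1 / 2)); nra.
rewrite Ha0 in Ek.
assert (Hr := rsq_nonneg); assert (HU := open_plane).
exists (radial_metric k); repeat split; trivial; exists a.
split; [|split; [exact Ha0|split]].
- apply soliton_ode_solution_on; [lra|lra|intros t Ht; now apply Da, J0].
- apply radial_riemannian; trivial.
    apply (smooth_comp _ HU J k rsq); trivial; [auto|now apply smooth_rsq].
  intros p _; specialize (Ek _ (J0 _ (Hr p))); destruct (Da _ (J0 _ (Hr p))) as [Hp _].
  nra.
- apply radial_to_polar; intros p Hp i j; unfold radial_metric.
  assert (Ht := rsq_pos p Hp); specialize (Ek _ (J0 _ (Hr p))).
  replace (k (rsq p)) with ((a (rsq p) ^ 2 - 1) / rsq p); [ring|].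
  simpl; rewrite Rmult_1_r, Ek; field; lra.
Qed.

Lemma g8_exists nu : 0 < nu -> exists g, is_g8 nu g.
Proof.
intros Hnu; assert (HP := PI_RGT_0).
set (gam := 2 * PI / nu); set (mu := - gam / 2).
assert (Hg : 0 < gam) by (apply Rdiv_lt_0_compat; lra).
destruct excess_inverse as [Z HZ].
set (a := soliton_solution Z (-1) gam 0).
assert (Ha : soliton_ode (-1) mu a).
  intros t Ht; apply (soliton_solution_derive Z HZ (-1) mu gam 0 t); trivial.
    unfold mu; lra.
  assert (0 < gam ^ 2) by nra; nra.
assert (HU := open_punctured_plane).
exists (radial_metric (fun t => (a t ^ 2 - 1) / t)), mu, a.
split; [unfold mu; lra|split; [fold gam; unfold mu; field|split; [|split; [|split]]]].
- apply soliton_ode_solution_on; [lra|unfold mu; lra|intros t Ht; now apply Ha].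
- apply soliton_solution_blowup; trivial; lra.
- apply (radial_riemannian punctured_plane (fun t => (a t ^ 2 - 1) / t)); trivial.
  + apply smooth_on_ext with (fun p => ((fun t => a t * a t) (rsq p) - 1) / rsq p); trivial.
      intros; simpl; now rewrite Rmult_1_r.
    assert (Sr : smooth_on punctured_plane rsq) by now apply smooth_rsq.
    apply smooth_div; trivial.
    * apply smooth_minus; trivial; [|now apply smooth_const].
      apply (smooth_comp _ HU (fun t => 0 < t) (fun t => a t * a t) rsq); trivial.
        apply (smooth1_soliton_ode (-1) mu _ a); [apply Ha|].
        apply polynomial_mult; constructor.
      apply rsq_pos.
    * intros p Hp; apply Rgt_not_eq, rsq_pos, Hp.
  + intros p Hp; assert (Ht := rsq_pos p Hp); destruct (Ha _ Ht) as [Hpos _].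
    replace (1 + rsq p * ((a (rsq p) ^ 2 - 1) / rsq p)) with (a (rsq p) ^ 2)
      by (field; lra); nra.
- now apply radial_to_polar.
Qed.

Lemma g7_soliton nu lam mu g : 2 * PI < nu -> is_g7 nu lam mu g ->
  nonhyperbolic_expanding_disc plane g lam.
Proof.
intros Hnu [Hl [Hm [E [a [Hsol [Ha0 [Hg Hpol]]]]]]]; assert (HP := PI_RGT_0).
assert (Hgam : 0 < 2 * mu / lam < 1).
  rewrite E; split; [apply Rdiv_lt_0_compat; lra|].
  apply Rmult_lt_reg_r with nu; [lra|]; field_simplify; lra.
assert (Ha : soliton_ode lam mu a).
  apply solution_on_soliton_ode with (fun t => 0 <= t); trivial; intros; lra.
(* One-sided differentiability at 0 gives right continuity, which carries the initial condition over
   to t > 0. *)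
assert (Hlim : filterlim a (at_right 0) (locally 1)).
  destruct (Hsol 0 (Rle_refl 0)) as [_ D].
  assert (C : filterlim a (within (fun t => 0 <= t) (locally 0)) (locally (a 0))).
    apply (@filterdiff_continuous_aux _ R_NormedModule R_NormedModule _
      (within_filter _ _ _ _) a).
      eexists; exact D.
    intros P HP'; apply filter_le_within, HP'.
  rewrite Ha0 in C; intros P HP'; specialize (C P HP').
  unfold filtermap, at_right, within in *; revert C; apply filter_imp.
  intros t Ht Ht0; apply Ht; lra.
assert (Hev : forall eps t, 0 < eps -> 0 < t -> exists s, 0 < s < t /\ Rabs (a s - 1) < eps).
  intros eps t Heps Ht.
  assert (W := Hlim _ (locally_ball 1 (mkposreal eps Heps))).
  destruct W as [d Hd]; assert (Hd0 := cond_pos d).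
  assert (M1 := Rmin_l (d / 2) (t / 2)); assert (M2 := Rmin_r (d / 2) (t / 2)).
  assert (M0 : 0 < Rmin (d / 2) (t / 2)) by (apply Rmin_pos; lra).
  exists (Rmin (d / 2) (t / 2)); split; [lra|].
  apply Hd; [|exact M0].
  unfold ball; simpl; unfold AbsRing_ball, abs, minus, plus, opp; simpl.
  rewrite Rabs_right; lra.
assert (Hgt : forall t, 0 < t -> 2 * mu / lam < a t).
  apply soliton_ode_above; trivial; intros t Ht.
  (* Being closer to 1 than the gap 1 - gamma puts a(s) above gamma. *)
  destruct (Hev (1 - 2 * mu / lam) t ltac:(lra) Ht) as [s [Hs Es]].
  exists s; split; [assumption|]; apply Rabs_def2 in Es; lra.
assert (Hle : forall t, 0 < t -> a t <= 1).
  intros t Ht; apply Rle_plus_epsilon; intros eps Heps.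
  destruct (Hev eps t Heps Ht) as [s [Hs Es]]; apply Rabs_def2 in Es.
  assert (D := soliton_ode_nonincreasing lam mu a Ha Hl Hgt s t ltac:(lra)); lra.
assert (Eg := polar_to_radial a g
  (riemannian_sub punctured_plane plane g open_punctured_plane (fun _ _ => I) Hg) Hpol).
split; [assumption|split; [|split; [|split; [|split]]]].
- now apply (plane_soliton lam mu a).
- apply (plane_complete lam mu a); trivial; [lra|].
  intros t Ht; split; auto.
- intros p _; apply (plane_curvature_neg lam mu a); trivial; lra.
- apply plane_homeomorphic_disc.
- now apply (plane_not_hyperbolic lam mu a).
Qed.

Lemma g8_universal_cover nu g : 0 < nu -> is_g8 nu g ->
  riemannian_universal_cover half_plane (pullback polar g) polar punctured_plane g /\
  nonhyperbolic_expanding_disc half_plane (pullback polar g) (-1).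
Proof.
intros Hnu [mu [a [Hm [E [Hsol [Hlim [Hg Hpol]]]]]]].
assert (Ha : soliton_ode (-1) mu a).
  apply solution_on_soliton_ode with (fun t => 0 < t); trivial; lra.
assert (Hgt : forall t, 0 < t -> 2 * mu / (-1) < a t).
  apply soliton_ode_above; trivial; [lra|]; intros t Ht.
  assert (W : at_right 0 (fun s => 2 * mu / (-1) < a s))
    by (apply Hlim; now exists (2 * mu / (-1))).
  destruct W as [d Hd]; assert (Hd0 := cond_pos d).
  assert (M1 := Rmin_l (d / 2) (t / 2)); assert (M2 := Rmin_r (d / 2) (t / 2)).
  assert (M0 : 0 < Rmin (d / 2) (t / 2)) by (apply Rmin_pos; lra).
  exists (Rmin (d / 2) (t / 2)); split; [lra|].
  apply Hd; [|exact M0].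
  unfold ball; simpl; unfold AbsRing_ball, abs, minus, plus, opp; simpl.
  rewrite Rabs_right; lra.
assert (Hr : riemannian half_plane (pullback polar g))
  by now apply (G_riemannian (-1) mu a).
split.
  split; [assumption|split; [apply half_plane_simply_connected|]].
  split; [apply polar_covering|split; [apply smooth_map_polar|reflexivity]].
split; [lra|split; [|split; [|split; [|split]]]].
- now apply (G_soliton (-1) mu a).
- apply (half_plane_complete (-1) mu a); trivial.
  now apply (soliton_ode_blowup_rate mu a).
- intros p Hp; rewrite (G_curvature (-1) mu a) by assumption.
  specialize (Hgt _ Hp); destruct (Ha _ Hp) as [Hpos _].
  apply Rmult_lt_reg_r with (a (fst p)); [assumption|].
  replace ((-1 - 2 * mu / a (fst p)) * a (fst p)) with (- a (fst p) - 2 * mu)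
    by (field; lra).
  lra.
- apply half_plane_homeomorphic_disc.
- intros H; destruct (isometric_hyperbolic_curvature _ _ Hr H) as [K HK].
  apply (soliton_ode_curvature_nonconstant (-1) mu a K); trivial; [lra|].
  intros t Ht; rewrite <- (HK (t, 0) Ht).
  now rewrite (G_curvature (-1) mu a).
Qed.

Theorem corollary2 :
  (exists (U : pt -> Prop) (g : metric) (lam : R),
     nonhyperbolic_expanding_disc U g lam) /\
  (forall nu : R, 2 * PI < nu ->
     (forall lam mu : R, lam < 0 -> mu < 0 -> 2 * mu / lam = 2 * PI / nu ->
        exists g : metric, is_g7 nu lam mu g) /\
     (forall (lam mu : R) (g : metric), is_g7 nu lam mu g ->
        nonhyperbolic_expanding_disc plane g lam)) /\
  (forall nu : R, 0 < nu ->
     (exists g : metric, is_g8 nu g) /\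
     (forall g : metric, is_g8 nu g ->
        riemannian_universal_cover half_plane (pullback polar g) polar
          punctured_plane g /\
        nonhyperbolic_expanding_disc half_plane (pullback polar g) (-1))).
Proof.
split; [|split].
(* The parameter value 1 is an arbitrary choice. *)
- destruct (g8_exists 1 Rlt_0_1) as [g Hg].
  exists half_plane, (pullback polar g), (-1).
  now apply (g8_universal_cover 1 g Rlt_0_1).
- intros nu Hnu; split; intros.
    now apply g7_exists.
  now apply g7_soliton with nu mu.
- intros nu Hnu; split; [now apply g8_exists|].
  intros g; now apply g8_universal_cover.
Qed.
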